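(* Let $N\ge 3$ and $k\ge 3$ be integers, let $\Gamma=\gamma_k\times\gamma_N$ be the non-skew toroidal grid constructed from $N$-cycles (the Cartesian product of a cycle on $k$ vertices and a cycle on $N$ vertices), and let $G=\Gamma\setminus v$ be the graph obtained from $\Gamma$ by deleting one vertex $v$ together with its incident edges. Suppose $|V(G)|\ge 3N-1$. Then $c_2^{(2)}(G)=0$.
   Context: $\gamma_i$ denotes the cycle on $i$ vertices. The non-skew toroidal grid indexed by $(k,0)$ and $(0,N)$, with $k,N\ge 3$, is the integer lattice (edges joining points at distance $1$) modulo identification of points whose difference is $(k,0)$ or $(0,N)$; it is the Cartesian product $\gamma_k\times\gamma_N$. It is 4-regular and all its vertices are equivalent under automorphisms. Deleting a vertex from a connected 4-regular graph is called decompletion. For a connected graph $G$, assign a variable $\alpha_e$ to each edge $e$. The Kirchhoff polynomial is $\Psi_G=\sum_T\prod_{e\notin T}\alpha_e$, the sum running over all spanning trees $T$ of $G$. For a prime $p$, $[\Psi_G]_p$ is the number of zeros of $\Psi_G$ in $\mathbb{F}_p^{|E(G)|}$. If $G$ has at least 3 vertices, then $[\Psi_G]_p$ is divisible by $p^2$, and the $c_2$ invariant of $G$ at $p$ is $c_2^{(p)}(G)=\frac{[\Psi_G]_p}{p^2}\bmod p$. *)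

(* Defs.v *)
From mathcomp Require Import all_boot all_order all_algebra.
From mathcomp Require Import mpoly.

Set Implicit Arguments.
Unset Strict Implicit.
Unset Printing Implicit Defensive.

Import GRing.Theory.

Record sgraph := SGraph {
  vertex :> finType;
  adj : rel vertex;
  adj_sym : ssrbool.symmetric adj;
  adj_irr : irreflexive adj
}.

Definition edges (G : sgraph) : {set {set G}} :=
  [set [set xy.1; xy.2] | xy : G * G & adj xy.1 xy.2].

(* [ordS] is the successor modulo [n]. The condition [i != j] only matters for
   [n = 1]; for [3 <= n] this is the usual cycle on [n] vertices. *)
Definition cycle_adj (n : nat) : rel 'I_n :=
  fun i j => (i != j) && ((j == ordS i) || (i == ordS j)).

Lemma cycle_adj_sym n : ssrbool.symmetric (@cycle_adj n).
Proof. by move=> i j; rewrite /cycle_adj eq_sym orbC. Qed.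

Lemma cycle_adj_irr n : irreflexive (@cycle_adj n).
Proof. by move=> i; rewrite /cycle_adj eqxx. Qed.

Definition cycle_graph (n : nat) : sgraph :=
  SGraph (@cycle_adj_sym n) (@cycle_adj_irr n).

Definition cartesian_adj (G H : sgraph) : rel (G * H) :=
  fun x y => ((x.1 == y.1) && adj x.2 y.2) || (adj x.1 y.1 && (x.2 == y.2)).

Lemma cartesian_adj_sym G H : ssrbool.symmetric (@cartesian_adj G H).
Proof.
move=> x y; rewrite /cartesian_adj (adj_sym x.1) (adj_sym x.2).
by rewrite (eq_sym x.1) (eq_sym x.2).
Qed.

Lemma cartesian_adj_irr G H : irreflexive (@cartesian_adj G H).
Proof. by move=> x; rewrite /cartesian_adj !adj_irr andbF. Qed.

Definition cartesian (G H : sgraph) : sgraph :=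
  SGraph (@cartesian_adj_sym G H) (@cartesian_adj_irr G H).

Definition del_adj (G : sgraph) (v : G) : rel {x : G | x != v} :=
  fun x y => adj (val x) (val y).

Lemma del_adj_sym G v : ssrbool.symmetric (@del_adj G v).
Proof. by move=> x y; apply: adj_sym. Qed.

Lemma del_adj_irr G v : irreflexive (@del_adj G v).
Proof. by move=> x; apply: adj_irr. Qed.

Definition del_vertex (G : sgraph) (v : G) : sgraph :=
  SGraph (@del_adj_sym G v) (@del_adj_irr G v).

Definition edge_rel (V : finType) (T : {set {set V}}) : rel V :=
  fun x y => [set x; y] \in T.

Definition edge_connected (V : finType) (T : {set {set V}}) : bool :=
  [forall x, forall y, connect (edge_rel T) x y].

(* A graph cycle is a cyclic sequence of at least three distinct vertices, so
   its length is at most #|V|; the bound on [n] keeps this boolean. *)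
Definition edge_acyclic (V : finType) (T : {set {set V}}) : bool :=
  [forall n : 'I_#|V|.+1, forall c : n.-tuple V,
     (2 < n) ==> ~~ ucycleb (edge_rel T) c].

Definition spanning_tree (G : sgraph) (T : {set {set G}}) : bool :=
  [&& T \subset edges G, edge_connected T & edge_acyclic T].

Local Open Scope ring_scope.

(* The variable attached to the edge [enum_val i] is ['X_i]. *)
Definition kirchhoff (G : sgraph) : {mpoly int[#|edges G|]} :=
  \sum_(T : {set {set G}} | spanning_tree T)
    \prod_(i < #|edges G| | enum_val i \notin T) 'X_i.

(* Number of zeros over ['F_p]; meaningful for prime [p]. *)
Definition zero_count (p n : nat) (P : {mpoly int[n]}) : nat :=
  #|[set a : {ffun 'I_n -> 'F_p} |
      (map_mpoly (intr : int -> 'F_p) P).@[a] == 0]|.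

(* The residue is represented by a natural number below [p]. When [G] is
   connected with at least 3 vertices, [p ^ 2] divides the count, so the
   division is exact. *)
Definition c2 (p : nat) (G : sgraph) : nat :=
  ((zero_count p (kirchhoff G) %/ p ^ 2) %% p)%N.

(* Main.v *)
(** Over F_2, [Psi_G] at the point whose support is [A] is the determinant of a
    symmetric matrix indexed by edges and vertices, so all parities of counts of
    spanning trees and forests become statements about kernels.  Let [u] be a
    vertex of degree 3 of [G] (a neighbour of the deleted vertex) with
    neighbours [w1, w2, w3], and let [H] be [G] without [u].  As a function of
    the three variables at [u],
      [Psi_G = f0 (a1 a2 + a1 a3 + a2 a3) + a1 (f2 + f3) + a2 (f1 + f3) + a3 (f1 + f2) + h],
    where [f0] counts spanning trees of [H] and [fi] spanning 2-forests
    separating [wi] from the other two; if [f0 = 0] then at most one [fi] is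
    nonzero.  Counting zeros in [(a1, a2, a3)], the number of zeros of [Psi_G] is
    [4 * #{f0 + (1 + f0) (f1 + f2 + f3) = 1}] modulo 8, and expanding the
    polynomials shows that the last cardinal has the parity of the number of
    disjoint pairs (spanning tree of [H], such a 2-forest of [H]).

    The reflection of the torus fixing the deleted vertex and [u] acts on these
    pairs, so only invariant pairs [(T, F)] matter.  There are none: on pairs of
    invariant F_2-valued vertex functions, being constant along [T], respectively
    along [F], together with the vanishing at the pinned vertices, imposes fewer
    linear conditions than there are unknowns (this is where [2 < N] enters), so
    [T] is not a spanning tree or [F] is not a 2-forest of the required kind. *)
Require Import Defs.
From HB Require Import structures.
From mathcomp Require Import all_boot all_order all_algebra.
From mathcomp Require Import mpoly ring zify.

Set Implicit Arguments.
Unset Strict Implicit.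
Unset Printing Implicit Defensive.

Import GRing.Theory.
Local Open Scope ring_scope.

(** * Sums over F_2 and determinants indexed by finite types *)

Lemma F2_cases (x : 'F_2) : x = 0 \/ x = 1.
Proof.
by case: x => [[|[|//]] ?]; [left | right]; apply/val_inj.
Qed.

Lemma F2_addxx (x : 'F_2) : x + x = 0.
Proof. by case: (F2_cases x) => ->; apply/val_inj. Qed.

Lemma F2_neq0 (x : 'F_2) : x != 0 -> x = 1.
Proof. by case: (F2_cases x) => -> //; rewrite eqxx. Qed.

Lemma F2_add_eq0 (x y : 'F_2) : x + y = 0 -> x = y.
Proof. by case: (F2_cases x) => ->; case: (F2_cases y) => -> // /(congr1 val). Qed.

Lemma F2_eq_zero (x y : 'F_2) : (x == 0) = (y == 0) -> x = y.
Proof. by case: (F2_cases x) => ->; case: (F2_cases y) => ->. Qed.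

(** Orbits of size two cancel in characteristic 2; comparing ranks picks one element of each such
    orbit. *)
Lemma sum_involution (I : finType) (P : pred I) (s : I -> I) (f : I -> 'F_2) :
    involutive s -> (forall i, P (s i) = P i) -> (forall i, P i -> f (s i) = f i) ->
  \sum_(i | P i) f i = \sum_(i | P i && (s i == i)) f i.
Proof.
move=> sK Ps fs; rewrite (bigID (fun i => s i == i)) /= [X in _ + X](_ : _ = 0) ?addr0 //.
rewrite (bigID (fun i => enum_rank i < enum_rank (s i))%N) /=.
rewrite [X in _ + X](reindex_inj (inv_inj sK)) /=.
rewrite [X in _ + X](eq_big (fun i => P i && (s i != i) && (enum_rank i < enum_rank (s i))%N) f).
- exact: F2_addxx.
- move=> i; rewrite Ps sK (eq_sym i) -leqNgt; case: (eqVneq (s i) i) => sx; rewrite ?andbF //.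
  congr (_ && _); rewrite leq_eqVlt; case: (_ =P _) => // /ord_inj/enum_rank_inj/eqP.
  by rewrite eq_sym (negPf sx).
by move=> i; rewrite Ps => /andP[/andP[Pi _] _]; apply: fs.
Qed.

HB.lock Definition fdet (R : fieldType) (X : finType) (M : X -> X -> R) : R :=
  \det (\matrix_(i < #|X|, j < #|X|) M (enum_val i) (enum_val j)).

Section FinDet.
Variables (R : fieldType) (X : finType).
Implicit Type M : X -> X -> R.

Lemma sum_enum_val (F : X -> R) : \sum_(i < #|X|) F (enum_val i) = \sum_x F x.
Proof. by rewrite -(big_enum_val (A := X)); apply: eq_bigl. Qed.

Lemma eq_fdet M M' : (forall x z, M x z = M' x z) -> fdet M = fdet M'.
Proof. by move=> eqM; rewrite fdet.unlock; congr (\det _); apply/matrixP => i j; rewrite !mxE. Qed.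

Lemma fdet_tr M : fdet (fun x z => M z x) = fdet M.
Proof. by rewrite fdet.unlock -[RHS]det_tr; congr (\det _); apply/matrixP => i j; rewrite !mxE. Qed.

Lemma fdet_eq0P M :
  reflect (exists2 xi : X -> R, exists x, xi x != 0 &
             forall x, \sum_z M x z * xi z = 0)
          (fdet M == 0).
Proof.
rewrite fdet.unlock -det_tr; apply: (iffP det0P) => [[v vN0 vM]|[xi [x xiN0] xiM]].
  exists (fun x => v 0 (enum_rank x)).
    have [j vj] : exists j, v 0 j != 0.
      by apply/rV0Pn.
    by exists (enum_val j); rewrite enum_valK.
  move=> x; move/rowP/(_ (enum_rank x)): vM; rewrite !mxE => {2}<-.
  rewrite -sum_enum_val; apply: eq_bigr => i _.
  by rewrite enum_valK !mxE enum_rankK mulrC.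
exists (\row_i xi (enum_val i)).
  by apply/rV0Pn; exists (enum_rank x); rewrite mxE enum_rankK.
apply/rowP => i; rewrite !mxE -[RHS](xiM (enum_val i)) -sum_enum_val.
by apply: eq_bigr => j _; rewrite !mxE mulrC.
Qed.

Lemma fdet_solve M (r : X -> R) : fdet M != 0 ->
  exists xi : X -> R, forall x, \sum_z M x z * xi z = r x.
Proof.
rewrite fdet.unlock; set A := (X in \det X) => dN0.
have uA : A \in unitmx by rewrite unitmxE unitfE.
pose w := invmx A *m (\col_i r (enum_val i)).
exists (fun x => w (enum_rank x) 0) => x.
have /colP/(_ (enum_rank x)) : A *m w = \col_i r (enum_val i) by rewrite mulKVmx.
rewrite !mxE enum_rankK => <-; rewrite -sum_enum_val.
by apply: eq_bigr => i _; rewrite enum_valK !mxE enum_rankK.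
Qed.

Lemma fdet_rowD M M1 M2 x0 :
    (forall z, M x0 z = M1 x0 z + M2 x0 z) ->
    (forall x z, x != x0 -> M1 x z = M x z) ->
    (forall x z, x != x0 -> M2 x z = M x z) ->
  fdet M = fdet M1 + fdet M2.
Proof.
move=> e0 e1 e2; rewrite fdet.unlock.
rewrite (determinant_multilinear (B := \matrix_(i, j) M1 (enum_val i) (enum_val j))
  (C := \matrix_(i, j) M2 (enum_val i) (enum_val j)) (i0 := enum_rank x0) (b := 1) (c := 1)).
- by rewrite !mul1r.
- by apply/rowP => j; rewrite !mxE enum_rankK !mul1r e0.
- apply/matrixP => i j; rewrite !mxE e1 //.
  by apply/eqP => /(congr1 enum_rank); rewrite enum_valK => /eqP;
    rewrite eq_sym (negPf (neq_lift _ _)).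
- apply/matrixP => i j; rewrite !mxE e2 //.
  by apply/eqP => /(congr1 enum_rank); rewrite enum_valK => /eqP;
    rewrite eq_sym (negPf (neq_lift _ _)).
Qed.

End FinDet.

(** * Pinned incidence matrices *)

Section Incidence.
Variable V : finType.
Implicit Types (D A S T : {set {set V}}) (p : V -> option V).
Implicit Types (x : V -> 'F_2) (y : {set V} -> 'F_2).

Definition cobd x (e : {set V}) : 'F_2 := \sum_(v in e) x v.
Definition bd D y (v : V) : 'F_2 := \sum_(e in D | v \in e) y e.

(* Rows and columns are indexed by all subsets of [V], of which only those in [D]
   are edges: a row outside [D] reads [y e = 0].  On [D] the weight of [e] is 1
   if [e \in A] and 0 otherwise, and the row of [e] reads
   [(e \in A) y e + x v + x w = 0] for [e = [set v; w]].  The row of [v] reads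
   [x c = 0] if [p v = Some c] and requires zero boundary of [y] at [v]
   otherwise, so [p] encodes which rows and columns a minor omits. *)
Definition pinned_mx D A p (r c : {set V} + V) : 'F_2 :=
  match r, c with
  | inl e, inl e' => ((e == e') && ((e \in D) ==> (e \in A)))%:R
  | inl e, inr v => ((e \in D) && (v \in e))%:R
  | inr v, inl e => [&& p v == None, e \in D & v \in e]%:R
  | inr v, inr v' => (p v == Some v')%:R
  end.

Definition pinned_det D A p : 'F_2 := fdet (pinned_mx D A p).

(** A kernel vector of [pinned_mx] split into a chain [y] on the edges and a potential [x] on the
    vertices. *)
Definition pinned_ker D A p y x : Prop :=
  [/\ forall e, e \notin D -> y e = 0,
      forall e, e \in D -> (e \in A)%:R * y e + cobd x e = 0
    & forall v, (if p v is Some c then x c else bd D y v) = 0].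

Lemma cobd2 x v w : v != w -> cobd x [set v; w] = x v + x w.
Proof. by move=> vw; rewrite /cobd big_setU1 ?inE //= big_set1. Qed.

Lemma bd_setD1 D y e v :
  e \in D -> bd D y v = (v \in e)%:R * y e + bd (D :\ e) y v.
Proof.
move=> eD; rewrite /bd big_mkcondr (big_setD1 e) //= [in RHS]big_mkcondr /=.
by congr (_ + _); case: ifP; rewrite ?mul1r ?mul0r.
Qed.

Lemma eq_bd D y y' v : {in D, y =1 y'} -> bd D y v = bd D y' v.
Proof. by move=> eqy; apply: eq_bigr => e /andP[eD _]; rewrite eqy. Qed.

(** Boundary and coboundary are adjoint: both sides sum [y e * x v] over incident pairs. *)
Lemma sum_bd D y x : \sum_v x v * bd D y v = \sum_(e in D) y e * cobd x e.
Proof.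
under eq_bigr do rewrite mulr_sumr.
rewrite (exchange_big_dep (mem D)) /=; last by move=> ? ? _ /andP[].
apply: eq_bigr => e eD; rewrite mulr_sumr; apply: eq_big => v; first by rewrite eD.
by rewrite mulrC.
Qed.

Lemma sum_bool1 (I : finType) (i : I) (b : bool) (F : I -> 'F_2) :
  \sum_j ((i == j) && b)%:R * F j = b%:R * F i.
Proof.
rewrite (bigD1 i) //= eqxx big1 ?addr0 // => j.
by rewrite eq_sym => /negPf ->; rewrite mul0r.
Qed.

Lemma sum_natb (I : finType) (P : pred I) (F : I -> 'F_2) :
  \sum_j (P j)%:R * F j = \sum_(j | P j) F j.
Proof.
by rewrite [RHS]big_mkcond; apply: eq_bigr => j _; case: (P j); rewrite ?mul1r ?mul0r.
Qed.

Lemma pinned_mx_edge D A p e (xi : {set V} + V -> 'F_2) :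
  \sum_z pinned_mx D A p (inl e) z * xi z =
  if e \in D then (e \in A)%:R * xi (inl e) + cobd (xi \o inr) e else xi (inl e).
Proof.
rewrite big_sumType /= sum_bool1 sum_natb.
case: ifP => eD /=; first by [].
by rewrite big_pred0 // mul1r addr0.
Qed.

Lemma pinned_mx_vertex D A p v (xi : {set V} + V -> 'F_2) :
  \sum_z pinned_mx D A p (inr v) z * xi z =
  if p v is Some c then xi (inr c) else bd D (xi \o inl) v.
Proof.
rewrite big_sumType /= !sum_natb.
case: (p v) => [c|] /=; last by rewrite [X in _ + X]big_pred0 // addr0.
rewrite big_pred0 // add0r (big_pred1 c) //.
Qed.

Lemma pinned_mx_kerP D A p (xi : {set V} + V -> 'F_2) :
  (forall r, \sum_z pinned_mx D A p r z * xi z = 0) <->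
  pinned_ker D A p (xi \o inl) (xi \o inr).
Proof.
split=> [K | [K1 K2 K3]].
  split=> [e /negPf eD | e eD | v].
  - by have := K (inl e); rewrite pinned_mx_edge eD.
  - by have := K (inl e); rewrite pinned_mx_edge eD.
  by have := K (inr v); rewrite pinned_mx_vertex.
case=> [e|v]; last by rewrite pinned_mx_vertex; apply: K3.
rewrite pinned_mx_edge; case: ifPn => eD; first exact: K2.
exact: (K1 e eD).
Qed.

Lemma pinned_det_eq0P D A p :
  pinned_det D A p = 0 <->
  exists y x, pinned_ker D A p y x /\ ((exists e, y e != 0) \/ exists v, x v != 0).
Proof.
split=> [/eqP/fdet_eq0P[xi [z zN0] /pinned_mx_kerP K] | [y [x [K N0]]]].
  exists (xi \o inl), (xi \o inr); split=> //.
  by case: z zN0 => [e|v] zN0; [left; exists e | right; exists v].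
apply/eqP/fdet_eq0P; exists (fun z => match z with inl e => y e | inr v => x v end).
  by case: N0 => [[e eN0]|[v vN0]]; [exists (inl e) | exists (inr v)].
exact/pinned_mx_kerP.
Qed.

Lemma pinned_det_neq0 D A p y x :
  pinned_det D A p != 0 -> pinned_ker D A p y x -> y =1 (fun=> 0) /\ x =1 (fun=> 0).
Proof.
move=> dN0 K; split=> z; apply/eqP; apply: contraNT dN0 => zN0; apply/eqP/pinned_det_eq0P;
  exists y, x; split=> //; [left | right]; by exists z.
Qed.

(** Over F_2 two determinants agree as soon as they vanish together, so identities between them
    reduce to transforming kernel vectors. *)
Lemma pinned_det_eq D A p D' A' p' :
    (pinned_det D A p = 0 -> pinned_det D' A' p' = 0) ->
    (pinned_det D' A' p' = 0 -> pinned_det D A p = 0) ->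
  pinned_det D A p = pinned_det D' A' p'.
Proof. by move=> H1 H2; apply: F2_eq_zero; apply/eqP/eqP. Qed.

Lemma eq_pinned_det D A p A' p' :
  {in D, A =i A'} -> p =1 p' -> pinned_det D A p = pinned_det D A' p'.
Proof.
move=> eqA eqp; apply: eq_fdet => -[e|v] [e'|v'] //=; rewrite ?eqp //.
by case: (boolP (e \in D)) => //= eD; rewrite eqA.
Qed.

(* Splitting the row of [e]: the weight part deletes [e]. *)
Lemma pinned_det_rec D A p e : e \in D -> e \in A ->
  pinned_det D A p = pinned_det D (A :\ e) p + pinned_det (D :\ e) (A :\ e) p.
Proof.
move=> eD eA.
pose M2 r c := if r == inl e then (c == inl e)%:R else pinned_mx D A p r c.
have -> : pinned_det (D :\ e) (A :\ e) p = fdet M2.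
  have M2row xi r : \sum_z M2 r z * xi z =
      if r == inl e then xi (inl e) else \sum_z pinned_mx D A p r z * xi z.
    rewrite /M2; case: ifP => // _; rewrite sum_natb big_sumType /= [X in _ + X]big_pred0 //.
    by rewrite addr0 (big_pred1 e).
  (* Once [y e = 0], the edge [e] contributes to no other row, so [M2] and the matrix without [e]
     have the same kernel. *)
  have key xi r : xi (inl e) = 0 ->
      \sum_z M2 r z * xi z = \sum_z pinned_mx (D :\ e) (A :\ e) p r z * xi z.
    move=> e0; rewrite M2row; case: r => [e'|v].
      rewrite (_ : inl e' == inl e = (e' == e)) // !pinned_mx_edge !inE.
      by case: eqVneq => [->|].
    rewrite !pinned_mx_vertex; case: (p v) => //.
    by rewrite (@bd_setD1 D _ e) //= e0 mulr0 add0r.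
  apply: F2_eq_zero; apply/fdet_eq0P/fdet_eq0P => -[xi N0 K]; exists xi => // r.
    rewrite key //; have := K (inl e); rewrite pinned_mx_edge !inE eqxx //.
  rewrite -key //; have := K (inl e); rewrite M2row eqxx //.
apply: (@fdet_rowD _ _ _ _ _ (inl e)) => [z | r z rN | r z rN].
- rewrite /M2 eqxx; case: z => [e'|v] /=; rewrite ?eD ?eA /=.
    by rewrite !inE eqxx andbF add0r andbT eq_sym.
  by rewrite addr0.
- case: r rN => [e'|//] rN /=; case: z => [e''|//].
  by rewrite !inE; case: (eqVneq e' e) rN => [->|//]; rewrite eqxx.
by rewrite /M2 (negPf rN).
Qed.

(** The recursion either deletes an edge of weight 1 or resets its weight to 0; [S] is the set of
    surviving edges. This is the matrix-tree expansion: [S] carries the monomial of the variables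
    outside [S], evaluated at the point with support [A]. *)
Lemma pinned_det_expand D A p :
  pinned_det D A p =
  \sum_(S : {set {set V}} | (S \subset D) && (D :\: S \subset A)) pinned_det S set0 p.
Proof.
have [n] := ubnP #|D :&: A|; elim: n D A => // n IHn D A /ltnSE leDA.
have [DA0|/set0Pn[e]] := eqVneq (D :&: A) set0.
  rewrite (big_pred1 D) => [|S].
    apply: eq_pinned_det => // e eD; rewrite inE; apply/negP => eA.
    by have : e \in D :&: A by [rewrite inE eD]; rewrite DA0 inE.
  apply/andP/eqP => [[SD DSA] | ->]; last by rewrite setDv sub0set.
  apply/eqP; rewrite eqEsubset SD; apply/subsetP => e eD.
  apply: contraT => eS; have : e \in D :&: A.
    by rewrite inE eD (subsetP DSA) // inE eS.
  by rewrite DA0 inE.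
rewrite inE => /andP[eD eA].
have lt_e D' : D' \subset D -> (#|D' :&: (A :\ e)| < n)%N.
  move=> D'D; apply: leq_trans leDA; apply: proper_card; rewrite properE.
  apply/andP; split; first by rewrite setISS // subD1set.
  by apply/negP => /subsetP/(_ e); rewrite !inE eD eA eqxx andbF => /(_ isT).
rewrite (pinned_det_rec _ eD eA) !IHn ?lt_e ?subD1set //.
rewrite [RHS](bigID (fun S => e \in S)) /=; congr (_ + _); apply: eq_bigl => S.
  case: (boolP (e \in S)) => eS; rewrite ?andbT ?andbF.
    congr (_ && _); apply/subsetP/subsetP => sub f fDS; first by have /setD1P[] := sub f fDS.
    by rewrite !inE sub // andbT; apply: contraTneq fDS => ->; rewrite inE eS.
  apply/negbTE/negP => /andP[_ /subsetP/(_ e)]; rewrite !inE eS eD eqxx => /(_ isT) //.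
case: (boolP (e \in S)) => eS; rewrite ?andbT ?andbF.
  by apply/negbTE/negP => /andP[/subsetP/(_ e eS)]; rewrite !inE eqxx.
rewrite subsetD1 eS andbT; congr (_ && _).
apply/subsetP/subsetP => sub f; rewrite !inE => /andP[fS].
  move=> fD; have [->//|fe] := eqVneq f e.
  by have /setD1P[] : f \in A :\ e by rewrite sub // !inE fS fe.
by move=> /andP[fe fD]; rewrite fe sub // inE fS.
Qed.

End Incidence.

(** * Pinned vertices: contraction, cofactor identities, sums over all points *)

Section Pins.
Variable V : finType.
Implicit Types (D A S T : {set {set V}}) (s : seq (V * V)).
Implicit Types (x : V -> 'F_2) (y : {set V} -> 'F_2).

(** The first entry for a vertex wins. A pair [(v, v)] grounds [v]; a pair [(r, c)] with distinct
    entries selects an off-diagonal minor. *)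
Fixpoint pins s (v : V) : option V :=
  if s is (r, c) :: s' then if v == r then Some c else pins s' v else None.

(* An edge of weight 0 at the root [u] forces [x w = 0], and [y] on this edge is
   then determined by the boundary condition at [w]. *)
Lemma pinned_det_contract D A s u w :
    [set u; w] \in D -> [set u; w] \notin A -> u != w ->
    pins s u = Some u -> pins s w = None ->
  pinned_det D A (pins s) = pinned_det (D :\ [set u; w]) A (pins ((w, w) :: s)).
Proof.
set e := [set u; w] => eD eA uw pu pw.
have eV v : pins s v = None -> v != w -> v \notin e.
  by move=> pv vw; rewrite !inE negb_or vw andbT; apply: contra_eqN pv => /eqP ->; rewrite pu.
apply: pinned_det_eq => /pinned_det_eq0P[y [x [[K1 K2 K3] N0]]]; apply/pinned_det_eq0P.
  have xw : x w = 0.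
    have := K2 e eD; rewrite (negPf eA) mul0r add0r cobd2 //.
    by have := K3 u; rewrite pu => ->; rewrite add0r.
  pose y' f := if f == e then 0 else y f.
  have y'E v : bd (D :\ e) y' v = bd (D :\ e) y v.
    by apply: eq_bd => f /setD1P[/negPf fe _]; rewrite /y' fe.
  exists y', x; split; first split.
  - by move=> f; rewrite !inE negb_and negbK /y'; case: eqP => //= _ /K1.
  - by move=> f /setD1P[/negPf fe fD]; rewrite /y' fe; apply: K2.
  - move=> v /=; case: (eqVneq v w) => [//|vw]; have := K3 v.
    case pv: (pins s v) => [//|]; rewrite y'E (bd_setD1 _ _ eD).
    by rewrite (negPf (eV _ pv vw)) mul0r add0r.
  case: N0 => [[f fN0]|]; last by right.
  left; case: (pickP (fun f => y' f != 0)) => [g gN0|y'0]; first by exists g.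
  have fe : f = e.
    by apply/eqP; apply: contraT => fe; have := y'0 f; rewrite /y' (negPf fe) fN0.
  have := K3 w; rewrite pw (bd_setD1 _ _ eD) -y'E !inE eqxx orbT mul1r.
  rewrite [bd _ _ _]big1 => [|g _]; last by apply/eqP/negbFE/y'0.
  by rewrite addr0 -fe => f0; rewrite f0 eqxx in fN0.
pose y' f := if f == e then bd (D :\ e) y w else y f.
have y'E v : bd (D :\ e) y' v = bd (D :\ e) y v.
  by apply: eq_bd => f /setD1P[/negPf fe _]; rewrite /y' fe.
have xw : x w = 0 by have := K3 w; rewrite /= eqxx.
have uwF : u == w = false by apply/negbTE.
exists y', x; split; first split.
- move=> f fD; rewrite /y'; case: eqP => [fe|/eqP fe]; first by rewrite fe eD in fD.
  by apply: K1; rewrite !inE negb_and fD orbT.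
- move=> f fD; rewrite /y'; case: eqP => [->|/eqP fe].
    rewrite (negPf eA) mul0r add0r cobd2 // xw addr0.
    by have := K3 u; rewrite /= uwF pu.
  by apply: K2; rewrite !inE fe.
- move=> v; have := K3 v; rewrite /=; case: (eqVneq v w) => [->|vw].
    rewrite pw (bd_setD1 _ _ eD) y'E /y' eqxx !inE eqxx orbT mul1r => _.
    exact: F2_addxx.
  case pv: (pins s v) => [//|]; rewrite (bd_setD1 _ _ eD) y'E.
  by rewrite (negPf (eV _ pv vw)) mul0r add0r.
case: N0 => [[f fN0]|]; last by right.
left; exists f; rewrite /y'; case: (f =P e) => // fe.
by rewrite fe K1 ?eqxx ?inE ?eqxx // in fN0.
Qed.

(** * Cofactor identities when the root is isolated *)

Section Rooted.
Variables (u : V) (D A : {set {set V}}).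
Hypothesis D2 : {in D, forall e : {set V}, #|e| = 2%N}.
Hypothesis Du : {in D, forall e : {set V}, u \notin e}.

(** The kernel conditions common to several choices of pins, with the boundary left free on [B];
    this allows different minors to be compared. *)
Definition open_ker (B : seq V) y x : Prop :=
  [/\ forall e, e \notin D -> y e = 0,
      forall e, e \in D -> (e \in A)%:R * y e + cobd x e = 0,
      forall v, v \notin B -> bd D y v = 0
    & x u = 0].

Definition nonzero y x := (exists e, y e != 0) \/ exists v, x v != 0.

(** Edges have two ends and avoid [u], so away from [u] a potential matters only up to a
    constant. *)
Definition shift x (c : 'F_2) v := x v + c * (v != u)%:R.

Lemma cobd_shift x c e : e \in D -> cobd (shift x c) e = cobd x e.
Proof.
move=> eD; rewrite /cobd big_split /= [X in _ + X](_ : _ = 0) ?addr0 //.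
rewrite (eq_bigr (fun=> c)) => [|v ve].
  by rewrite sumr_const D2 // mulr2n F2_addxx.
by rewrite (_ : v != u) ?mulr1 //; apply: contraNneq (Du eD) => <-.
Qed.

Lemma open_ker_shift B y x c : open_ker B y x -> open_ker B y (shift x c).
Proof.
by case=> K1 K2 K3 K4; split=> // [e eD|]; rewrite ?cobd_shift ?K2 // /shift K4 eqxx mulr0 addr0.
Qed.

Lemma bd_root y : bd D y u = 0.
Proof. by rewrite /bd big_pred0 // => e; apply/negP => /andP[/Du/negP]. Qed.

Lemma sum_bd0 y : \sum_v bd D y v = 0.
Proof.
have := sum_bd D y (fun=> 1); under eq_bigr do rewrite mul1r; move=> ->.
by rewrite big1 // => e eD; rewrite /cobd sumr_const D2 // mulr2n F2_addxx mulr0.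
Qed.

(** All boundaries sum to 0 and the one at [u] is 0, so the condition at one further vertex follows
    from the others. *)
Lemma open_ker1 w y x : open_ker [:: u; w] y x -> open_ker [::] y x.
Proof.
case=> K1 K2 K3 K4; split=> // v _; have [->|vu] := eqVneq v u; first exact: bd_root.
have [->|vw] := eqVneq v w; last by apply: K3; rewrite !inE negb_or vu.
rewrite -[RHS](sum_bd0 y) (bigD1 w) //= big1 ?addr0 // => z zw.
have [->|zu] := eqVneq z u; first exact: bd_root.
by apply: K3; rewrite !inE negb_or zu.
Qed.

Lemma open_ker_sub B B' y x : {subset B <= B'} -> open_ker B y x -> open_ker B' y x.
Proof.
by move=> BB' [K1 K2 K3 K4]; split=> // v vB'; apply: K3; apply: contra vB'; apply: BB'.
Qed.

Lemma pinned_ker1 w c y x : w != u ->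
  pinned_ker D A (pins [:: (u, u); (w, c)]) y x <-> open_ker [:: u; w] y x /\ x c = 0.
Proof.
move=> /negPf wu; split=> [[K1 K2 K3]|[[K1 K2 K3 K4] K5]].
  have := K3 u; have := K3 w; rewrite /= !eqxx wu => xc xu.
  split=> //; split=> // v; rewrite !inE negb_or => /andP[/negPf vu /negPf vw].
  by have := K3 v; rewrite /= vu vw.
split=> // v /=; case: eqP => // /eqP vu; case: eqP => // /eqP vw.
by apply: K3; rewrite !inE negb_or vu.
Qed.

Lemma pinned_ker2 w r c y x : uniq [:: u; w; r] ->
  pinned_ker D A (pins [:: (u, u); (w, w); (r, c)]) y x <->
  [/\ open_ker [:: u; w; r] y x, x w = 0 & x c = 0].
Proof.
rewrite /= !inE andbT negb_or => /andP[/andP[uw ur] wr].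
have [/negPf wu /negPf ru /negPf rw] : [/\ w != u, r != u & r != w] by rewrite !(eq_sym r) eq_sym.
split=> [[K1 K2 K3]|[[K1 K2 K3 K4] K5 K6]].
  have := K3 u; have := K3 w; have := K3 r; rewrite /= !eqxx wu ru rw => xc xw xu.
  split=> //; split=> // v; rewrite !inE !negb_or => /and3P[/negPf vu /negPf vw /negPf vr].
  by have := K3 v; rewrite /= vu vw vr.
split=> // v /=; case: eqP => // /eqP vu; case: eqP => // /eqP vw; case: eqP => // /eqP vr.
by apply: K3; rewrite !inE !negb_or vu vw.
Qed.

Lemma nonzero_shift y x c v : v != u -> x v = 0 -> nonzero y x -> nonzero y (shift x c).
Proof.
move=> vu xv [|[z zN0]]; first by left.
have [->|/F2_neq0 c1] := eqVneq c 0.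
  by right; exists z; rewrite /shift mul0r addr0.
by right; exists v; rewrite /shift xv vu c1 mulr1 add0r oner_eq0.
Qed.

Lemma shift_at x v : v != u -> shift x (x v) v = 0.
Proof. by move=> vu; rewrite /shift vu mulr1 F2_addxx. Qed.

Lemma pinned_det1_eq0P w c : w != u -> c != u ->
  pinned_det D A (pins [:: (u, u); (w, c)]) = 0 <->
  exists y x, [/\ open_ker [::] y x, x c = 0 & nonzero y x].
Proof.
move=> wu cu; split=> [/pinned_det_eq0P[y [x [/(pinned_ker1 _ _ _ wu)[K xc] N0]]]|].
  by exists y, x; split=> //; apply: open_ker1 K.
case=> y [x [K xc N0]]; apply/pinned_det_eq0P; exists y, x; split=> //.
by apply/pinned_ker1 => //; split=> //; apply: open_ker_sub K.
Qed.

(** The analogue of the equality of all cofactors of a Laplacian: the omitted boundary row is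
    redundant by [open_ker1], and a shift moves the zero of the potential from [c] to [c']. *)
Lemma pinned_det_const w c w' c' : w != u -> c != u -> w' != u -> c' != u ->
  pinned_det D A (pins [:: (u, u); (w, c)]) = pinned_det D A (pins [:: (u, u); (w', c')]).
Proof.
suff H a b a' b' : a != u -> b != u -> a' != u -> b' != u ->
    pinned_det D A (pins [:: (u, u); (a, b)]) = 0 ->
    pinned_det D A (pins [:: (u, u); (a', b')]) = 0.
  by move=> *; apply: pinned_det_eq; apply: H.
move=> au bu au' bu' /pinned_det1_eq0P[//|//|y [x [K xb N0]]].
apply/pinned_det1_eq0P => //; exists y, (shift x (x b')); split.
- exact: open_ker_shift.
- exact: shift_at.
exact: nonzero_shift bu xb N0.
Qed.

(** The potential equal to 1 everywhere except at the isolated vertex [u] lies in the kernel. *)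
Lemma pinned_det_root v : v != u -> pinned_det D A (pins [:: (u, u)]) = 0.
Proof.
move=> vu; apply/pinned_det_eq0P; exists (fun=> 0), (shift (fun=> 0) 1); split.
  split=> // [e eD|w]; first by rewrite mulr0 add0r cobd_shift // /cobd big1.
  rewrite /=; case: eqP => _; first by rewrite /shift eqxx mulr0 addr0.
  by rewrite /bd big1.
by right; exists v; rewrite /shift vu add0r mulr1 oner_eq0.
Qed.

(** Apart from the pinned rows the matrix is symmetric, so transposing exchanges omitted rows with
    pinned columns. *)
Lemma pinned_det_tr w r c : uniq [:: u; w; r; c] ->
  pinned_det D A (pins [:: (u, u); (w, w); (r, c)]) =
  pinned_det D A (pins [:: (u, u); (w, w); (c, r)]).
Proof.
suff H a b : uniq [:: u; w; a; b] ->
    pinned_det D A (pins [:: (u, u); (w, w); (a, b)]) = 0 ->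
    pinned_det D A (pins [:: (u, u); (w, w); (b, a)]) = 0.
  move=> U; have U' : uniq [:: u; w; c; r].
    by rewrite -(perm_uniq (s1 := [:: u; w; r; c])) // !perm_cons (perm_catC [:: r] [:: c]).
  by apply: pinned_det_eq; apply: H.
move=> U; have /and3P[/and3P[uw ua ub] /andP[wa wb] ab] :
    [&& [&& u != w, u != a & u != b], (w != a) && (w != b) & a != b].
  by move: U; rewrite /= !inE andbT !negb_or.
rewrite /pinned_det -fdet_tr => /eqP/fdet_eq0P[xi N0 K]; apply/pinned_det_eq0P.
set p := pins _ in K.
(* The entries of [xi] at pinned rows are multipliers, not potentials, and [x] is 0 there. By [Kv]
   each multiplier equals the boundary of [y] at the column that its row pins. *)
pose y e := xi (inl e); pose x v := if p v == None then xi (inr v) else 0.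
have Ke e : (((e \in D) ==> (e \in A))%:R * y e + (if e \in D then cobd x e else 0)) = 0.
  have := K (inl e); rewrite big_sumType /=.
  rewrite (bigD1 e) //= eqxx [X in _ + X + _]big1 => [|f /negPf ->]; last by rewrite mul0r.
  rewrite addr0 => E; rewrite -[RHS]E; congr (_ + _).
  case: (boolP (e \in D)) => eD /=; last by rewrite big1 // => v _; rewrite andbF mul0r.
  rewrite sum_natb /cobd /x big_mkcond [RHS]big_mkcond; apply: eq_bigr => v _.
  by case: (p v == None) => //=; case: ifP.
have Kv v : bd D y v + \sum_(z | p z == Some v) xi (inr z) = 0.
  have := K (inr v); rewrite big_sumType /= !sum_natb => E; rewrite -[RHS]E; congr (_ + _).
have pE z : p z = if z == u then Some u else if z == w then Some w else if z == a then Some b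
                  else None by [].
have [/negPf wu /negPf au /negPf aw] : [/\ w != u, a != u & a != w] by rewrite !(eq_sym a) eq_sym.
have [/negPf bu /negPf bw /negPf ba] : [/\ b != u, b != w & b != a] by rewrite !(eq_sym b).
have U' : uniq [:: u; w; b] by rewrite /= !inE negb_or uw ub wb.
have sum1 v z : p z = Some v -> (forall z', p z' = Some v -> z' = z) ->
    bd D y v + xi (inr z) = 0.
  move=> pz pz'; rewrite -[RHS](Kv v) (big_pred1 z) // => z'.
  by apply/eqP/eqP => [/pz'|->].
exists y, x; split; first apply/pinned_ker2 => //.
  split; last first.
  - by rewrite /x pE au aw eqxx.
  - by rewrite /x pE wu eqxx.
  split.
  - by move=> e /negPf eD; have := Ke e; rewrite eD mul1r addr0.
  - by move=> e eD; have := Ke e; rewrite eD.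
  - move=> v; rewrite !inE !negb_or => /and3P[vu vw vb].
    have := Kv v; rewrite big_pred0 ?addr0 // => z; rewrite pE.
    case: ifP => _; first by rewrite (inj_eq (@Some_inj _)) eq_sym (negPf vu).
    case: ifP => _; first by rewrite (inj_eq (@Some_inj _)) eq_sym (negPf vw).
    by case: ifP => _ //; rewrite (inj_eq (@Some_inj _)) eq_sym (negPf vb).
  by rewrite /x pE eqxx.
case: N0 => -[e eN0|v vN0]; first by left; exists e.
(* If [y] vanishes then so do all multipliers, being boundaries of [y]; the nonzero entry of [xi] is
   thus one of [x]. *)
have [[e eN0]|y0] := altP (existsP (P := fun e => y e != 0)); first by left; exists e.
have {}y0 e : y e = 0 by apply/eqP; move/existsPn: y0 => /(_ e); rewrite negbK.
right; exists v; rewrite /x; case pv: (p v) => [c'|] //=.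
suff xv0 : xi (inr v) = 0 by rewrite xv0 eqxx in vN0.
have := @sum1 c' v pv; rewrite /bd big1 // add0r; apply.
move=> z; move: pv; rewrite !pE.
case: (eqVneq v u) => [->|_].
  move=> [<-]; case: (eqVneq z u) => // _; case: (eqVneq z w) => [->|_]; first by move=> [/eqP];
    rewrite wu.
  by case: (eqVneq z a) => // _ [/eqP]; rewrite bu.
case: (eqVneq v w) => [->|_].
  move=> [<-]; case: (eqVneq z u) => [_ [/eqP]|_]; first by rewrite (negPf uw).
  case: (eqVneq z w) => // _.
  by case: (eqVneq z a) => // _ [/eqP]; rewrite bw.
case: (eqVneq v a) => // -> [<-].
case: (eqVneq z u) => [_ [/eqP]|_]; first by rewrite (negPf ub).
case: (eqVneq z w) => [_ [/eqP]|_]; first by rewrite (negPf wb).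
by case: (eqVneq z a).
Qed.

(** A 2-forest separating [w] from [w'] has [w''] on exactly one side, which accounts for the two
    terms. *)
Lemma pinned_det_pair w w' w'' : uniq [:: u; w; w'; w''] ->
  pinned_det D A (pins [:: (u, u); (w, w); (w', w')]) =
  pinned_det D A (pins [:: (u, u); (w, w); (w', w'')]) +
  pinned_det D A (pins [:: (u, u); (w', w'); (w, w'')]).
Proof.
move=> U; have /and3P[/and3P[uw uw' uw''] /andP[ww' ww''] w'w''] :
    [&& [&& u != w, u != w' & u != w''], (w != w') && (w != w'') & w' != w''].
  by move: U; rewrite /= !inE andbT !negb_or.
have U1 : uniq [:: u; w; w'] by rewrite /= !inE negb_or uw uw' ww'.
have U2 : uniq [:: u; w'; w] by rewrite /= !inE negb_or uw uw' eq_sym ww'.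
set p1 := pins [:: _; _; (w', w')]; set p2 := pins [:: _; _; (w', w'')].
(* The row of [w'] in [M] is the sum of its rows for [p1] and [p2] and reads [x w' = x w''].
   Shifting from [x w = 0] to [x w' = 0] yields the system of the last determinant. *)
pose M r c := pinned_mx D A p1 r c + ((r == inr w') && (c == inr w''))%:R.
have Mrow xi r : \sum_z M r z * xi z =
    \sum_z pinned_mx D A p1 r z * xi z + (r == inr w')%:R * xi (inr w'').
  under eq_bigr do rewrite mulrDl; rewrite big_split /=; congr (_ + _).
  rewrite (bigD1 (inr w'')) //= eqxx andbT big1 ?addr0 // => c /negPf ->.
  by rewrite andbF mul0r.
have [w'u w'w] : w' == u = false /\ w' == w = false by rewrite !(eq_sym w') !(introF eqP _) //;
  exact/eqP.
have eM : fdet M = pinned_det D A p1 + pinned_det D A p2.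
  apply: (@fdet_rowD _ _ _ _ _ (inr w')) => [z | r z rN | r z rN].
    rewrite /M eqxx /=; congr (_ + _); case: z => [e|v]; rewrite /p2 /= w'u w'w eqxx //.
    by rewrite (inj_eq (@Some_inj _)) eq_sym.
    by rewrite /M (negPf rN) addr0.
  rewrite /M (negPf rN) addr0; case: r rN => // v.
  rewrite (_ : inr v == inr w' = (v == w')) // => /negPf vw'.
  by rewrite /p1 /p2 /= vw'.
suff -> : pinned_det D A (pins [:: (u, u); (w', w'); (w, w'')]) = fdet M.
  by rewrite eM addrCA F2_addxx addr0.
have Mker xi : (forall r, \sum_z M r z * xi z = 0) <->
    [/\ open_ker [:: u; w; w'] (xi \o inl) (xi \o inr), xi (inr w) = 0
      & xi (inr w') = xi (inr w'')].
  have row_e e : \sum_z M (inl e) z * xi z =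
      if e \in D then (e \in A)%:R * xi (inl e) + cobd (xi \o inr) e else xi (inl e).
    by rewrite Mrow mul0r addr0 pinned_mx_edge.
  have row_v v : \sum_z M (inr v) z * xi z = if v == u then xi (inr u) else
      if v == w then xi (inr w) else if v == w' then xi (inr w') + xi (inr w'')
      else bd D (xi \o inl) v.
    rewrite Mrow pinned_mx_vertex /p1 (_ : inr v == inr w' = (v == w')) //=.
    case: eqP => [->|_]; first by rewrite eq_sym w'u mul0r addr0.
    case: eqP => [->|_]; first by rewrite eq_sym w'w mul0r addr0.
    by case: eqP => _; rewrite ?mul1r ?mul0r ?addr0.
  split=> [H|[[K1 K2 K3 K4] xw xw']].
    have := row_v w'; rewrite H w'u w'w eqxx => /esym/F2_add_eq0 xw'.
    have wu : w == u = false by rewrite eq_sym (negPf uw).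
    have := row_v w; rewrite H wu eqxx => xw; split=> //; split.
    - by move=> e /negPf eD; have := row_e e; rewrite H eD.
    - by move=> e eD; have := row_e e; rewrite H eD.
    - move=> v; rewrite !inE !negb_or => /and3P[/negPf vu /negPf vw /negPf vw'].
      by have := row_v v; rewrite H vu vw vw'.
    by have := row_v u; rewrite H eqxx.
  case=> [e|v]; first by rewrite row_e; case: ifPn => [/K2|/K1].
  rewrite row_v; case: (eqVneq v u) => // vu; case: (eqVneq v w) => // vw.
  case: (eqVneq v w') => [|vw']; first by rewrite xw' F2_addxx.
  by apply: K3; rewrite !inE !negb_or vu vw.
have swap y x : open_ker [:: u; w; w'] y x <-> open_ker [:: u; w'; w] y x.
  by split; apply: open_ker_sub => v; rewrite !inE; case/or3P => ->; rewrite ?orbT.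
have neu z : u != z -> z != u by rewrite eq_sym.
apply: F2_eq_zero; apply/eqP/fdet_eq0P => [/pinned_det_eq0P[y [x [/(pinned_ker2 _ _ _ U2)[K xw'
  xw''] N0]]]|].
  pose xi z := match z with inl e => y e | inr v => shift x (x w) v end.
  exists xi.
    case: (nonzero_shift (x w) (neu _ uw') xw' N0) => -[z zN0]; first by exists (inl z).
    by exists (inr z).
  apply/Mker; split; first exact/open_ker_shift/swap.
  - by rewrite /= shift_at // neu.
  by rewrite /= /shift xw' xw'' !(neu _) // .
case=> xi [z zN0] /Mker[K xw xw'].
apply/pinned_det_eq0P; exists (xi \o inl), (shift (xi \o inr) (xi (inr w'))); split.
  apply/pinned_ker2 => //; split; first exact/open_ker_shift/swap.
  - by rewrite shift_at // neu.
  by rewrite /shift /= xw' neu // mulr1 F2_addxx.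
apply: (@nonzero_shift _ _ _ w) => //; first exact: neu.
by case: z zN0 => [e|v] zN0; [left; exists e | right; exists v].
Qed.

(** Equal values at [w] and [c] could be shifted to 0, giving a kernel vector of the pinned system.
    The zero at [v] keeps the shifted vector nonzero. *)
Lemma pinned_det_separates w r c y x v : uniq [:: u; w; r; c] ->
    pinned_det D A (pins [:: (u, u); (w, w); (r, c)]) != 0 ->
    open_ker [::] y x -> nonzero y x -> v != u -> x v = 0 -> x w != x c.
Proof.
move=> U dN0 K N0 vu xv; apply: contra dN0 => /eqP xwc; apply/eqP/pinned_det_eq0P.
have /and3P[uw ur uc] : [&& u != w, u != r & u != c].
  by move: U; rewrite /= !inE !negb_or => /andP[].
have U' : uniq [:: u; w; r].
  by move: U; rewrite -[[:: u; w; r; c]]/([:: u; w; r] ++ [:: c]) cat_uniq => /andP[].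
exists y, (shift x (x w)); split; last exact: nonzero_shift vu xv N0.
apply/pinned_ker2 => //; split.
- exact/open_ker_shift/(open_ker_sub _ K).
- by rewrite shift_at // eq_sym.
by rewrite xwc shift_at // eq_sym.
Qed.

(* A nonconstant kernel vector [x] separates [w1] from [w2] and [w3] if the first
   factor is nonzero, and [w2] from [w1] and [w3] if the second is; over F_2 both
   cannot happen. *)
Lemma pinned_det_exclusive w1 w2 w3 : uniq [:: u; w1; w2; w3] ->
    pinned_det D A (pins [:: (u, u); (w3, w3)]) = 0 ->
  pinned_det D A (pins [:: (u, u); (w1, w1); (w2, w3)]) *
  pinned_det D A (pins [:: (u, u); (w2, w2); (w1, w3)]) = 0.
Proof.
move=> U; have /and3P[/and3P[uw1 uw2 uw3] /andP[w12 w13] w23] :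
    [&& [&& u != w1, u != w2 & u != w3], (w1 != w2) && (w1 != w3) & w2 != w3].
  by move: U; rewrite /= !inE andbT !negb_or.
have U132 : uniq [:: u; w1; w3; w2].
  by rewrite /= !inE !negb_or uw1 uw2 uw3 w12 w13 eq_sym w23.
have U213 : uniq [:: u; w2; w1; w3].
  by rewrite /= !inE !negb_or uw1 uw2 uw3 w13 w23 eq_sym w12.
have w3u : w3 != u by rewrite eq_sym.
move=> /pinned_det1_eq0P[//|//|y [x [K xw3 N0]]].
apply/eqP; apply: contraT; rewrite mulf_eq0 negb_or => /andP[d1 d2].
have := pinned_det_separates U d1 K N0 w3u xw3.
have := pinned_det_separates U213 d2 K N0 w3u xw3.
rewrite pinned_det_tr // in d1.
have := pinned_det_separates U132 d1 K N0 w3u xw3.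
by case: (F2_cases (x w1)) => ->; case: (F2_cases (x w2)) => ->; rewrite xw3.
Qed.

End Rooted.

(** Deletion and contraction of an edge at the grounded vertex [u], with [b] the value of its
    variable: deleting it contributes the factor [b], contracting it grounds [w]. *)
Lemma pinned_det_peel D A s u w (b : bool) :
    [set u; w] \notin D -> [set u; w] \notin A -> u != w ->
    pins s u = Some u -> pins s w = None ->
  pinned_det ([set u; w] |: D) (if b then [set u; w] |: A else A) (pins s) =
  b%:R * pinned_det D A (pins s) + pinned_det D A (pins ((w, w) :: s)).
Proof.
move=> eD eA uw pu pw; case: b.
  rewrite (@pinned_det_rec _ _ _ _ [set u; w]) ?setU11 // !setU1K // mul1r addrC.
  by rewrite (@pinned_det_contract (_ |: D) A s u w) ?setU11 // setU1K.
by rewrite mul0r add0r (@pinned_det_contract (_ |: D) A s u w) ?setU11 // setU1K.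
Qed.

Lemma sum_subsets_setU1 (R : nmodType) D (e : {set V}) (F : {set {set V}} -> R) : e \notin D ->
  \sum_(A : {set {set V}} | A \subset e |: D) F A =
  \sum_(A : {set {set V}} | A \subset D) (F A + F (e |: A)).
Proof.
move=> eD; rewrite (bigID (fun A => e \in A)) /= addrC big_split /=; congr (_ + _).
  apply: eq_bigl => A; apply/andP/idP => [[/subsetP sA eA]|sA].
    apply/subsetP => f fA; have /setU1P[fe|//] := sA f fA.
    by rewrite fe (negPf eA) in fA.
  by rewrite (contra (subsetP sA e)) // (subset_trans sA) // subsetUr.
rewrite (reindex_onto (fun A => e |: A) (fun A => A :\ e)) => [|A /andP[_ eA]]; last exact: setD1K.
apply: eq_bigl => A; rewrite setU11 andbT; apply/andP/idP => [[sA /eqP AE]|sA].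
  apply/subsetP => f fA; have /setU1P[fe|//] : f \in e |: D.
    by apply: (subsetP sA); rewrite inE fA orbT.
  by move: fA; rewrite -AE fe !inE eqxx.
by rewrite setUS // setU1K // (contra (subsetP sA e)).
Qed.

(** The number of supersets of [B] within [D] is a power of 2, odd only for [B = D]. *)
Lemma sum_supersets D (B : {set {set V}}) : B \subset D ->
  \sum_(A : {set {set V}} | A \subset D) (B \subset A)%:R = (B == D)%:R :> 'F_2.
Proof.
move=> BD; have [->|BnD] := eqVneq B D.
  rewrite (bigD1 D) //= subxx big1 ?addr0 // => A /andP[AD AnD].
  by rewrite (_ : D \subset A = false) //; apply: contraNF AnD => DA; rewrite eqEsubset AD.
have /subsetPn[e eD eB] : ~~ (D \subset B).
  by apply: contra BnD => DB; rewrite eqEsubset BD.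
rewrite -(setD1K eD) sum_subsets_setU1 ?setD11 // big1 // => A _.
suff -> : (B \subset e |: A) = (B \subset A) by rewrite F2_addxx.
by rewrite -subDset (_ : B :\: [set e] = B) //; apply/setDidPl; rewrite disjoint_sym disjoints1.
Qed.

Lemma pinned_det_expandM D A p :
  pinned_det D A p =
  \sum_(S : {set {set V}} | S \subset D) (D :\: S \subset A)%:R * pinned_det S set0 p.
Proof.
rewrite pinned_det_expand big_mkcondr; apply: eq_bigr => S _.
by case: ifP => _; rewrite ?mul1r ?mul0r.
Qed.

Lemma setD_eq_self D S : S \subset D -> (D :\: S == D) = (S == set0).
Proof.
move=> SD; apply/eqP/eqP => [DSD|->]; last by rewrite setD0.
apply/eqP; rewrite -subset0; apply/subsetP => e eS.
by have := subsetP SD e eS; rewrite -{1}DSD inE eS.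
Qed.

(** Summing over all points of F_2^D keeps only the monomial in all variables, which belongs to
    [S = set0]. *)
Lemma sum_pinned_det D p :
  \sum_(A : {set {set V}} | A \subset D) pinned_det D A p = pinned_det set0 set0 p.
Proof.
under eq_bigr do rewrite pinned_det_expandM.
rewrite exchange_big /= (bigD1 set0) ?sub0set //= [X in _ + X]big1 ?addr0.
  by rewrite -mulr_suml setD0 sum_supersets // eqxx mul1r.
move=> S /andP[SD /negPf S0].
by rewrite -mulr_suml sum_supersets ?subsetDl // setD_eq_self // S0 mul0r.
Qed.

(** The monomials of [T] and [F] together involve every variable exactly when no edge lies in both
    sets. *)
Lemma sum_pinned_det_mul D p q :
  \sum_(A : {set {set V}} | A \subset D) pinned_det D A p * pinned_det D A q =
  \sum_(TF : {set {set V}} * {set {set V}} |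
       [&& TF.1 \subset D, TF.2 \subset D & [disjoint TF.1 & TF.2]])
     pinned_det TF.1 set0 p * pinned_det TF.2 set0 q.
Proof.
transitivity (\sum_(T : {set {set V}} | T \subset D) \sum_(F : {set {set V}} | F \subset D)
    [disjoint T & F]%:R * (pinned_det T set0 p * pinned_det F set0 q)).
  under eq_bigr do rewrite !pinned_det_expandM mulr_suml.
  rewrite exchange_big /=; apply: eq_bigr => T TD.
  under eq_bigr do rewrite mulr_sumr.
  rewrite exchange_big /=; apply: eq_bigr => F FD.
  under eq_bigr do rewrite mulrACA -natrM mulnb -subUset.
  rewrite -mulr_suml sum_supersets ?subUset ?subsetDl //.
  by rewrite -setDIr setD_eq_self ?subIset ?TD // setI_eq0.
rewrite pair_big /= big_mkcondr -big_mkcondr [RHS](eq_bigl _ _ (fun TF => andbA _ _ _)).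
rewrite [RHS]big_mkcondr; apply: eq_bigr => -[T F] _ /=.
by case: ifP => _; rewrite ?mul1r ?mul0r.
Qed.

End Pins.

(** * Vertices of degree three *)

Section Reflection.
Variables (V : finType) (rho : V -> V).
Hypothesis rhoK : involutive rho.

Definition redge (e : {set V}) : {set V} := rho @: e.
Definition redges (S : {set {set V}}) : {set {set V}} := redge @: S.

Lemma redgeK : involutive redge.
Proof. by move=> e; rewrite /redge -imset_comp (eq_imset _ rhoK) imset_id. Qed.

Lemma redgesK : involutive redges.
Proof. by move=> S; rewrite /redges -imset_comp (eq_imset _ redgeK) imset_id. Qed.

Lemma mem_redge v e : (v \in redge e) = (rho v \in e).
Proof. by rewrite -{1}(rhoK v) mem_imset //; apply: inv_inj. Qed.

Lemma mem_redges e S : (e \in redges S) = (redge e \in S).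
Proof. by rewrite -{1}(redgeK e) mem_imset //; apply: inv_inj redgeK. Qed.

Lemma pinned_det_redges S p :
  pinned_det (redges S) set0 (fun v => omap rho (p (rho v))) = pinned_det S set0 p.
Proof.
have H T q : pinned_det T set0 q = 0 ->
    pinned_det (redges T) set0 (fun v => omap rho (q (rho v))) = 0.
  move=> /pinned_det_eq0P[y [x [[K1 K2 K3] N0]]]; apply/pinned_det_eq0P.
  exists (y \o redge), (x \o rho); split; first split.
  - by move=> e; rewrite mem_redges; apply: K1.
  - move=> e; rewrite mem_redges => /K2; rewrite !inE !mul0r !add0r => <-.
    rewrite /cobd [RHS]big_imset /=; last by move=> ? ? _ _; apply: (inv_inj rhoK).
    by [].
  - move=> v; have := K3 (rho v); case: (q (rho v)) => [c|] /=; first by rewrite rhoK.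
    move=> <-; rewrite /bd [RHS](reindex_inj (inv_inj redgeK)) /=.
    by apply: eq_bigl => e; rewrite mem_redges mem_redge rhoK.
  case: N0 => -[z zN0]; [left; exists (redge z) | right; exists (rho z)] => /=.
    by rewrite redgeK.
  by rewrite rhoK.
apply: pinned_det_eq; last exact: H.
move=> /H; rewrite redgesK => <-; apply: eq_pinned_det => // v.
by rewrite rhoK; case: (p v) => //= c; rewrite rhoK.
Qed.

End Reflection.

(** If [f0 = 1], then [psi] is, up to a constant, the majority function translated by
    [(f1, f2, f3)], which has 4 zeros. If [f0 = 0], it is a constant when all [fi] vanish, and
    otherwise a nonzero linear form plus a constant, again with 4 zeros. *)
Lemma conic_zero_count (f0 f1 f2 f3 h : 'F_2) (psi : bool -> bool -> bool -> 'F_2) :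
    (f0 = 0 -> [/\ f1 * f2 = 0, f1 * f3 = 0 & f2 * f3 = 0]) ->
    (forall b1 b2 b3 : bool, psi b1 b2 b3 =
       f0 * (b1%:R * b2%:R + b1%:R * b3%:R + b2%:R * b3%:R) +
       (b1%:R * (f2 + f3) + b2%:R * (f1 + f3) + b3%:R * (f1 + f2)) + h) ->
  let z b1 b2 b3 : nat := psi b1 b2 b3 == 0 in
  (z false false false + z true false false + (z false true false + z true true false) +
   (z false false true + z true false true + (z false true true + z true true true)) =
    4 * ((f0 + (1 + f0) * (f1 + f2 + f3))%R != 0%R) %[mod 8])%N.
Proof.
move=> H psiE z; rewrite /z !psiE; move: H.
case: (F2_cases f0) => ->; case: (F2_cases f1) => ->; case: (F2_cases f2) => ->;
  case: (F2_cases f3) => -> H; try (by case: (H erefl) => /eqP ? /eqP ? /eqP ?);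
  case: (F2_cases h) => ->; by [].
Qed.

Arguments pins {V} !s v /.

(** * The three spokes at a vertex of degree three *)

Section ThreeValent.
Variables (V : finType) (D : {set {set V}}) (u w1 w2 w3 : V).
Hypothesis D2 : {in D, forall e : {set V}, #|e| = 2%N}.
Hypothesis Du : {in D, forall e : {set V}, u \notin e}.
Hypothesis U : uniq [:: u; w1; w2; w3].

Let e1 := [set u; w1].
Let e2 := [set u; w2].
Let e3 := [set u; w3].

Let p0 := pins [:: (u, u); (w3, w3)].
Let p1 := pins [:: (u, u); (w1, w1); (w2, w3)].
Let p2 := pins [:: (u, u); (w2, w2); (w1, w3)].
Let p3 := pins [:: (u, u); (w3, w3); (w1, w2)].

Definition with_star := e1 |: (e2 |: (e3 |: D)).

Let distinct : [&& [&& u != w1, u != w2 & u != w3], (w1 != w2) && (w1 != w3) & w2 != w3].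
Proof. by move: U; rewrite /= !inE andbT !negb_or. Qed.

Let addif (b : bool) (e : {set V}) (A : {set {set V}}) := if b then e |: A else A.

Let spoke_notin w : [set u; w] \notin D.
Proof. by apply/negP => /Du; rewrite !inE eqxx. Qed.

Let spokes_neq : [/\ e1 != e2, e1 != e3 & e2 != e3].
Proof.
have /and3P[/and3P[uw1 uw2 uw3] /andP[w12 w13] w23] := distinct.
have eN w w' : u != w -> w != w' -> [set u; w] != [set u; w'].
  move=> uw ww'; apply/eqP => /setP/(_ w); rewrite !inE eqxx orbT.
  by rewrite eq_sym (negPf uw) (negPf ww').
by rewrite !eN.
Qed.

(** Peeling the spokes gives one term per set of grounded neighbours, times the variables of the
    other spokes. No grounded neighbour gives 0, a single one gives the determinant of [p0], and two
    split by [pinned_det_pair]. *)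
Lemma star_det (A : {set {set V}}) b1 b2 b3 : A \subset D ->
  pinned_det with_star (addif b1 e1 (addif b2 e2 (addif b3 e3 A))) (pins [:: (u, u)]) =
  pinned_det D A p0 * (b1%:R * b2%:R + b1%:R * b3%:R + b2%:R * b3%:R) +
  (b1%:R * (pinned_det D A p2 + pinned_det D A p3) +
   b2%:R * (pinned_det D A p1 + pinned_det D A p3) +
   b3%:R * (pinned_det D A p1 + pinned_det D A p2)) +
  pinned_det D A (pins [:: (u, u); (w1, w1); (w2, w2); (w3, w3)]).
Proof.
move=> AD; have /and3P[/and3P[uw1 uw2 uw3] /andP[w12 w13] w23] := distinct.
have [w1u w2u w3u] : [/\ w1 != u, w2 != u & w3 != u] by rewrite eq_sym uw1 eq_sym uw2 eq_sym uw3.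
have eA w : [set u; w] \notin A by apply: contra (spoke_notin w); apply: (subsetP AD).
have [/negPf e12 /negPf e13 /negPf e23] := spokes_neq.
have [/negPf e1D /negPf e2D] : e1 \notin D /\ e2 \notin D by split; apply: spoke_notin.
have [/negPf e1A /negPf e2A] : e1 \notin A /\ e2 \notin A by split; apply: eA.
have e2D' : e2 \notin e3 |: D by rewrite !inE e23 e2D.
have e2A' : e2 \notin addif b3 e3 A by rewrite /addif; case: b3; rewrite ?inE ?e23 ?e2A.
have e1D' : e1 \notin e2 |: (e3 |: D) by rewrite !inE e12 e13 e1D.
have e1A' : e1 \notin addif b2 e2 (addif b3 e3 A).
  by rewrite /addif; clear e2A'; case: b2; case: b3; rewrite ?inE ?e12 ?e13 ?e1A.
have [[uw1F uw2F] uw3F] := (negPf uw1, negPf uw2, negPf uw3).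
have [w1uF w2uF w3uF] : [/\ w1 == u = false, w2 == u = false & w3 == u = false].
  by split; apply/negbTE.
have [w21F w31F w32F] : [/\ w2 == w1 = false, w3 == w1 = false & w3 == w2 = false].
  by split; apply/negbTE; rewrite eq_sym.
pose P s := pinned_det D A (pins s).
have peel (e23' A' : {set {set V}}) s w b : [set u; w] \notin e23' -> [set u;
  w] \notin A' -> u != w ->
    pins s u = Some u -> pins s w = None ->
    pinned_det ([set u; w] |: e23') (addif b [set u; w] A') (pins s) =
    b%:R * pinned_det e23' A' (pins s) + pinned_det e23' A' (pins ((w, w) :: s)).
  exact: pinned_det_peel.
rewrite /with_star peel //= ?eqxx ?w1uF //.
rewrite !(peel (e3 |: D)) //= ?eqxx ?uw1F ?w2uF ?w21F //.
rewrite !(peel D) //= ?eqxx ?uw1F ?uw2F ?w3uF ?w31F ?w32F //.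
rewrite -!/(P _).
have perm_pins s s' : (pins s =1 pins s') -> P s = P s'.
  by move=> ss'; apply: eq_pinned_det.
have -> : P [:: (u, u)] = 0 by apply: pinned_det_root w1u.
have P1 w : w != u -> P [:: (w, w); (u, u)] = pinned_det D A p0.
  move=> wu; rewrite (@perm_pins _ [:: (u, u); (w, w)]); first exact: pinned_det_const.
  by move=> v /=; case: (eqVneq v w) => [->|//]; rewrite (negPf wu).
rewrite !P1 //.
have P2 w w' : w != u -> w' != u -> w != w' ->
    P [:: (w', w'); (w, w); (u, u)] = P [:: (u, u); (w, w); (w', w')].
  move=> wu w'u ww'; apply: perm_pins => v /=.
  case: (eqVneq v w') => [->|_]; first by rewrite (negPf w'u) eq_sym (negPf ww').
  by case: (eqVneq v w) => [->|//]; rewrite (negPf wu).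
rewrite !P2 //.
rewrite (_ : P [:: (w3, w3); _; _; _] = P [:: (u, u); (w1, w1); (w2, w2); (w3, w3)]); last first.
  apply: perm_pins => v /=.
  case: (eqVneq v w3) => [->|_]; first by rewrite w3uF w31F w32F.
  case: (eqVneq v w2) => [->|_]; first by rewrite w2uF w21F.
  by case: (eqVneq v w1) => [->|//]; rewrite w1uF.
have ne := (uw1F, uw2F, uw3F, negPf w12, negPf w13, negPf w23, w21F, w31F, w32F).
have d23 : P [:: (u, u); (w2, w2); (w3, w3)] = pinned_det D A p2 + pinned_det D A p3.
  rewrite /P (@pinned_det_pair _ _ _ _ D2 Du _ _ w1) /= ?inE ?ne //.
  by congr (_ + _); apply: pinned_det_tr => //; rewrite /= ?inE ?ne.
have d13 : P [:: (u, u); (w1, w1); (w3, w3)] = pinned_det D A p1 + pinned_det D A p3.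
  rewrite /P (@pinned_det_pair _ _ _ _ D2 Du _ _ w2) /= ?inE ?ne //.
  by congr (_ + _); apply: pinned_det_tr => //; rewrite /= ?inE ?ne.
have d12 : P [:: (u, u); (w1, w1); (w2, w2)] = pinned_det D A p1 + pinned_det D A p2.
  by rewrite /P (@pinned_det_pair _ _ _ _ D2 Du _ _ w3) /= ?inE ?ne.
rewrite d12 d13 d23 /P -/p0 -/p1 -/p2 -/p3; ring.
Qed.

(** Equal to 1 exactly when the number of zeros in the three spoke variables above the point [A] is
    4 modulo 8. *)
Let q A := pinned_det D A p0 +
  (1 + pinned_det D A p0) * (pinned_det D A p1 + pinned_det D A p2 + pinned_det D A p3).

Lemma zeros_star :
  (\sum_(A : {set {set V}} | A \subset with_star)
      (pinned_det with_star A (pins [:: (u, u)]) == 0%R) =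
    4 * (\sum_(A : {set {set V}} | A \subset D) (q A != 0%R)) %[mod 8])%N.
Proof.
have [/negPf e12 /negPf e13 /negPf e23] := spokes_neq.
have [/negPf e1D /negPf e2D e3D] : [/\ e1 \notin D, e2 \notin D & e3 \notin D].
  by split; apply: spoke_notin.
rewrite /with_star !sum_subsets_setU1 // ?inE ?e12 ?e13 ?e23 ?e1D ?e2D // big_distrr /=.
apply: (big_ind2 (fun m n => (m = n %[mod 8])%N)) => // [m1 n1 m2 n2 h1 h2|A AD].
  by have := modnDm m1 m2 8; rewrite h1 h2 modnDm => /esym.
pose psi b1 b2 b3 := pinned_det with_star (addif b1 e1 (addif b2 e2 (addif b3 e3 A)))
  (pins [:: (u, u)]).
(* [pinned_det_exclusive] needs both factors to share the last column; transposing and moving the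
   pin of [p0] brings every pair to this form. *)
have excl : pinned_det D A p0 = 0 ->
    [/\ pinned_det D A p1 * pinned_det D A p2 = 0, pinned_det D A p1 * pinned_det D A p3 = 0
      & pinned_det D A p2 * pinned_det D A p3 = 0].
  have /and3P[/and3P[uw1 uw2 uw3] /andP[w12 w13] w23] := distinct.
  have [[/negPf w21 /negPf w31] /negPf w32] : [/\ w2 != w1 & w3 != w1] /\ w3 != w2.
    by split; first split; rewrite eq_sym.
  have ne := (negPf uw1, negPf uw2, negPf uw3, negPf w12, negPf w13, negPf w23, w21, w31, w32).
  have f0' w : w != u -> pinned_det D A p0 = 0 -> pinned_det D A (pins [:: (u, u); (w, w)]) = 0.
    by move=> wu <-; apply: pinned_det_const => //; rewrite eq_sym.
  have tr w r c : uniq [:: u; w; r; c] -> pinned_det D A (pins [:: (u, u); (w, w); (r, c)]) =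
      pinned_det D A (pins [:: (u, u); (w, w); (c, r)]) by move=> ?; apply: pinned_det_tr.
  move=> f0; split.
  - by apply: pinned_det_exclusive.
  - rewrite [pinned_det D A p1]tr /= ?inE ?ne //.
    by apply: pinned_det_exclusive; rewrite /= ?inE ?ne // f0' // eq_sym.
  rewrite [pinned_det D A p2]tr /= ?inE ?ne // [pinned_det D A p3]tr /= ?inE ?ne //.
  by apply: pinned_det_exclusive; rewrite /= ?inE ?ne // f0' // eq_sym.
have E := @conic_zero_count _ _ _ _ _ psi excl (fun b1 b2 b3 => star_det b1 b2 b3 AD).
exact: etrans E.
Qed.

(** Together with [y = 0], such a potential is a kernel vector. *)
Lemma pinned_det_fun0 (S : {set {set V}}) p (x : V -> 'F_2) :
    (forall v c, p v = Some c -> x c = 0) -> {in S, forall e : {set V}, cobd x e = 0} ->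
    (exists v, x v != 0) ->
  pinned_det S set0 p = 0.
Proof.
move=> xp xS xN0; apply/pinned_det_eq0P; exists (fun=> 0), x; split; last by right.
split=> // [e eS|v]; first by rewrite mulr0 add0r xS.
by case pv: (p v) => [c|]; [apply: xp pv | rewrite /bd big1].
Qed.

Lemma pins_fun0 s (x : V -> 'F_2) : all (fun rc => x rc.2 == 0) s ->
  forall v c, pins s v = Some c -> x c = 0.
Proof.
elim: s => //= -[r c'] s IHs /= /andP[/eqP xc' xs] v c.
by case: ifP => [_ [<-] | _]; last apply: IHs.
Qed.

(** * Reduction to pairs of edge sets invariant under the reflection *)

Section Symmetric.
Variable rho : V -> V.
Hypothesis rhoK : involutive rho.
Hypothesis rho_u : rho u = u.
Hypothesis rho_w1 : rho w1 = w2.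
Hypothesis rho_w3 : rho w3 = w3.
Hypothesis rho_D : redges rho D = D.
Hypothesis no_pair : forall T F : {set {set V}},
  T \subset D -> F \subset D -> [disjoint T & F] ->
  redges rho T = T -> redges rho F = F -> forall w c : V,
  exists x x' : V -> 'F_2,
    [/\ all (fun v => x v == 0) [:: u; w3], all (fun v => x' v == 0) [:: u; w; c],
        {in T, forall e : {set V}, cobd x e = 0}, {in F, forall e : {set V}, cobd x' e = 0}
      & (exists v, x v != 0) \/ (exists v, x' v != 0)].

Let rho_w2 : rho w2 = w1. Proof. by rewrite -rho_w1 rhoK. Qed.

(** Summing over all points leaves pairs of disjoint edge sets, the linear terms vanishing with the
    determinants of the empty edge set. The reflection preserves the summand, so only invariant
    pairs survive, and [no_pair] makes each of them 0. *)
Lemma sum_q : \sum_(A : {set {set V}} | A \subset D) q A = 0.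
Proof.
have /and3P[/and3P[uw1 uw2 uw3] /andP[w12 w13] w23] := distinct.
have [[/negPf w21 /negPf w31] /negPf w32] : [/\ w2 != w1 & w3 != w1] /\ w3 != w2.
  by split; first split; rewrite eq_sym.
have ne := (negPf uw1, negPf uw2, negPf uw3, negPf w12, negPf w13, negPf w23, w21, w31, w32).
(* Without edges, the indicator of any vertex outside the pinned columns is a kernel vector. *)
have pin0 (s : seq (V * V)) (v : V) : all (fun rc => v != rc.2) s ->
      pinned_det set0 set0 (pins s) = 0.
  move=> sv; apply: (@pinned_det_fun0 _ _ (fun z => (z == v)%:R)).
  - apply: pins_fun0; apply: sub_all sv => rc; rewrite eq_sym => /negPf ->.
    by rewrite eqxx.
  - by move=> e; rewrite inE.
  by exists v; rewrite eqxx oner_eq0.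
have [[/negPf w1u /negPf w2u] /negPf w3u] : [/\ w1 != u & w2 != u] /\ w3 != u.
  by split; first split; rewrite eq_sym.
have z0 : pinned_det set0 set0 p0 = 0 by apply: (pin0 _ w1); rewrite /= w1u ?ne.
have z1 : pinned_det set0 set0 p1 = 0 by apply: (pin0 _ w2); rewrite /= w2u ?ne.
have z2 : pinned_det set0 set0 p2 = 0 by apply: (pin0 _ w1); rewrite /= w1u ?ne.
have z3 : pinned_det set0 set0 p3 = 0 by apply: (pin0 _ w1); rewrite /= w1u ?ne.
pose phi S := pinned_det S set0 p1 + pinned_det S set0 p2 + pinned_det S set0 p3.
have -> : \sum_(A : {set {set V}} | A \subset D) q A =
    \sum_(TF : {set {set V}} * {set {set V}} |
       [&& TF.1 \subset D, TF.2 \subset D & [disjoint TF.1 & TF.2]])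
     pinned_det TF.1 set0 p0 * phi TF.2.
  under eq_bigr do rewrite /q mulrDl mul1r !mulrDr.
  rewrite !big_split /= !sum_pinned_det !sum_pinned_det_mul -!big_split /=.
  rewrite z0 z1 z2 z3 ?add0r; apply: eq_bigr => TF _; rewrite /phi; ring.
have pinsE s s' S : pins s =1 (fun v => omap rho (pins s' (rho v))) ->
    pinned_det (redges rho S) set0 (pins s) = pinned_det S set0 (pins s').
  by move=> ss'; rewrite -(pinned_det_redges rhoK S (pins s')); apply: eq_pinned_det.
have rho_eq v z : (rho v == z) = (v == rho z) by rewrite -(inj_eq (inv_inj rhoK)) rhoK.
have t_inv S : pinned_det (redges rho S) set0 p0 = pinned_det S set0 p0.
  apply: pinsE => v; rewrite /= !rho_eq rho_u rho_w3.
  by case: ifP => _; rewrite /= ?rho_u //; case: ifP => _; rewrite /= ?rho_w3.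
(* The reflection swaps [p1] with [p2] and turns [p3] into its transpose. *)
have phi_inv S : phi (redges rho S) = phi S.
  rewrite /phi [X in _ = X + _]addrC; congr (_ + _ + _).
  - apply: pinsE => v; rewrite /= !rho_eq rho_u rho_w2 rho_w1.
    by do 3![case: ifP => _; rewrite /= ?rho_u ?rho_w2 ?rho_w3 //].
  - apply: pinsE => v; rewrite /= !rho_eq rho_u rho_w2 rho_w1.
    by do 3![case: ifP => _; rewrite /= ?rho_u ?rho_w1 ?rho_w3 //].
  rewrite [RHS]pinned_det_tr /= ?inE ?w3u ?ne //.
  apply: pinsE => v; rewrite /= !rho_eq rho_u rho_w2 rho_w3.
  by do 3![case: ifP => _; rewrite /= ?rho_u ?rho_w1 ?rho_w3 //].
have rsub (S : {set {set V}}) : (redges rho S \subset D) = (S \subset D).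
  have memD e : (redge rho e \in D) = (e \in D) by rewrite -(mem_redges rhoK) rho_D.
  apply/subsetP/subsetP => sub e eS; rewrite -memD; apply: sub.
    by rewrite (mem_redges rhoK) (redgeK rhoK).
  by rewrite -(mem_redges rhoK).
have rdisj (S S' : {set {set V}}) : [disjoint redges rho S & redges rho S'] = [disjoint S & S'].
  by rewrite (imset_disjoint (inv_inj (redgeK rhoK))).
rewrite (@sum_involution _ _ (fun TF : {set {set V}} * {set {set V}} => (redges rho TF.1, redges
  rho TF.2))); last first.
- by move=> [T F] /= _; rewrite t_inv phi_inv.
- by move=> [T F] /=; rewrite !rsub rdisj.
- by move=> [T F] /=; rewrite !(redgesK rhoK).
apply: big1 => -[T F] /= /andP[/and3P[TD FD TF] /eqP[rT rF]].
have t0 w r c : pinned_det T set0 p0 * pinned_det F set0 (pins [:: (u, u); (w, w); (r, c)]) = 0.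
  have [x [x' [/and3P[xu xw3 _] /and4P[x'u x'w x'c _] xT x'F N0]]] := no_pair TD FD TF rT rF w c.
  case: N0 => N0.
    by rewrite (pinned_det_fun0 _ xT N0) ?mul0r //; apply: pins_fun0; rewrite /= xu xw3.
  by rewrite (pinned_det_fun0 _ x'F N0) ?mulr0 //; apply: pins_fun0; rewrite /= x'u x'w x'c.
by rewrite /phi !mulrDr !t0 !addr0.
Qed.

End Symmetric.
End ThreeValent.

(** * Kirchhoff polynomials as determinants *)

Section SpanningTree.
Variable G : sgraph.
Implicit Types (T A : {set {set G}}).

Lemma edgesP (e : {set G}) :
  reflect (exists a b, [/\ adj a b, a != b & e = [set a; b]]) (e \in edges G).
Proof.
apply: (iffP imsetP) => [[[a b]]|[a [b [ab _ ->]]]].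
  rewrite inE /= => ab ->; exists a, b; split=> //; apply/eqP => E; by rewrite E adj_irr in ab.
by exists (a, b); rewrite ?inE.
Qed.

Lemma connect_edge_sym T : connect_sym (edge_rel T).
Proof. by apply: sym_connect_sym => a b; rewrite /edge_rel setUC. Qed.

Lemma cobd_connect0 T (x : G -> 'F_2) a b : T \subset edges G ->
    {in T, forall e, cobd x e = 0} -> connect (edge_rel T) a b -> x a = x b.
Proof.
move=> TG xT /connectP[s pth ->{b}]; elim: s a pth => //= b s IHs a /andP[ab /IHs <-].
have /edgesP[c [d [_ cd E]]] := subsetP TG _ ab.
case: (eqVneq a b) => [->//|neq]; have := xT _ ab; rewrite cobd2 // => /F2_add_eq0 //.
Qed.

Lemma cobd_component T (a : G) (z : 'F_2) (e : {set G}) : T \subset edges G -> e \in T ->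
  cobd (fun v => (connect (edge_rel T) a v)%:R + z) e = 0.
Proof.
move=> TG eT; have /edgesP[c [d [_ cd E]]] := subsetP TG _ eT.
rewrite E cobd2 // (_ : connect _ a d = connect (edge_rel T) a c).
  by rewrite addrACA !F2_addxx.
have cd1 : connect (edge_rel T) c d by apply: connect1; rewrite /edge_rel -E.
by rewrite !(connect_edge_sym _ a) (same_connect (@connect_edge_sym T) cd1).
Qed.

(** A kernel vector consists of a potential constant along [T] with value 0 at [u] and of a mod 2
    cycle [y]. Connectedness kills the first, acyclicity the second. *)
Lemma spanning_tree_det T (u : G) : T \subset edges G ->
  spanning_tree T = (pinned_det T set0 (pins [:: (u, u)]) != 0).
Proof.
move=> TG; rewrite /spanning_tree TG /=.
apply/andP/idP => [[/forallP conn acyc]|dN0].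
  apply/negP => /eqP/pinned_det_eq0P[y [x [[K1 K2 K3] N0]]].
  have xu : x u = 0 by have := K3 u; rewrite /= eqxx.
  have xT e : e \in T -> cobd x e = 0.
    by move=> /K2; rewrite inE mul0r add0r.
  have x0 v : x v = 0.
    by rewrite -(cobd_connect0 TG xT (forallP (conn u) v)).
  case: N0 => [[e yN0]|[v]]; last by rewrite x0 eqxx.
  have eT : e \in T by apply: contraNT yN0 => /K1 ->.
  have /edgesP[p [q [_ pq E]]] := subsetP TG _ eT.
  have TeG : T :\ e \subset edges G by apply: subset_trans TG; apply: subD1set.
  have : connect (edge_rel (T :\ e)) p q.
    apply: contraT => npq.
    (* If [e] were a bridge, [z] would indicate one side of its cut up to a constant, chosen so that
       [z u = 0] because the boundary is not prescribed at [u]. Pairing [z] with the boundary of [y]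
       would give [y e = 0]. *)
    pose z v : 'F_2 := (connect (edge_rel (T :\ e)) p v)%:R + (connect (edge_rel (T :\ e)) p u)%:R.
    have := sum_bd T y z; rewrite big1 => [|v _]; last first.
      case: (eqVneq v u) => [->|vu]; first by rewrite /z F2_addxx mul0r.
      by have := K3 v; rewrite /= (negPf vu) => ->; rewrite mulr0.
    rewrite (big_setD1 e) //= big1 => [|f fT]; last by rewrite (cobd_component _ _ TeG) ?mulr0.
    rewrite addr0 (F2_neq0 yN0) mul1r E cobd2 // /z connect0 (negPf npq) add0r.
    by rewrite -addrA F2_addxx addr0 => /eqP; rewrite eq_sym oner_eq0.
  move=> /connectP[s0 pth0 q0]; case/shortenP: pth0 q0 => s pth us _ q0.
  have cyc : ucycleb (edge_rel T) (p :: s).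
    rewrite /ucycleb us andbT /= rcons_path -q0 /edge_rel setUC -E eT andbT.
    by apply: sub_path pth => a b; rewrite /edge_rel inE => /andP[].
  have sz : (2 < size (p :: s))%N.
    case: s q0 pth {us cyc} => [/= qp|b [|//]] //=; first by rewrite qp eqxx in pq.
    by move=> <-; rewrite /edge_rel !inE E eqxx.
  have nV : (size (p :: s) < #|G|.+1)%N by rewrite ltnS -(card_uniqP us) max_card.
  move/forallP/(_ (Ordinal nV))/forallP/(_ (in_tuple (p :: s))): acyc.
  by rewrite cyc implybF -leqNgt leqNgt sz.
split.
  have connu v : connect (edge_rel T) u v.
    pose x v : 'F_2 := (connect (edge_rel T) u v)%:R + 1.
    have K : pinned_ker T set0 (pins [:: (u, u)]) (fun=> 0) x.
      split=> // [e eT|w].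
        by rewrite mulr0 add0r cobd_component.
      by rewrite /=; case: ifP => _; [rewrite /x connect0 F2_addxx | rewrite /bd big1].
    have [_ /(_ v)] := pinned_det_neq0 dN0 K.
    by rewrite /x; case: connect => //= /eqP; rewrite add0r oner_eq0.
  apply/forallP => a; apply/forallP => b; apply: connect_trans (connu b).
  by rewrite connect_edge_sym.
apply/forallP => n; apply/forallP => c; apply/implyP => n2; apply/negP.
case: c => -[|a [|b s]] /= /eqP sz; try by rewrite -sz in n2.
rewrite /ucycleb /= rcons_path => /andP[/and3P[ab pth la] /and3P[anbs bns us]].
set l := last b s in la; set e := [set l; a].
have sN : s != [::] by apply: contraTneq n2 => s0; rewrite -sz s0.
have ls : l \in s.
  have last_mem r : r != [::] -> last b r \in r by case: r => //= d r _; apply: mem_last.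
  exact: last_mem.
have lb : l != b by apply: contraNneq bns => <-.
(* Invertibility provides a potential with coboundary 1 on the closing edge [e] of the cycle and 0
   on the rest of [T]; going round the cycle the other way contradicts this. *)
have [xi xiE] := fdet_solve (fun z => (z == inl e)%:R) dN0.
pose x v := xi (inr v).
have xT f : f \in T -> cobd x f = (f == e)%:R.
  move=> fT; have := xiE (inl f); rewrite pinned_mx_edge fT inE mul0r add0r => ->.
  by [].
have xedge c d : edge_rel T c d -> [set c; d] != e -> x c = x d.
  move=> cd cde; have /edgesP[c' [d' [_ c'd' E]]] := subsetP TG _ cd.
  have := xT _ cd; rewrite (negPf cde).
  by case: (eqVneq c d) => [->//|cd']; rewrite cobd2 // => /F2_add_eq0.
have xlb : x l = x b.
  have xpath r d : a \notin d :: r -> path (edge_rel T) d r -> x (last d r) = x d.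
    elim: r d => //= d r IHr c; rewrite inE negb_or => /andP[ac adr] /andP[cd pthd].
    rewrite IHr //; apply/esym/xedge => //; apply/eqP => /setP/(_ a);
      rewrite !inE eqxx orbT (negPf ac).
    by move: adr; rewrite inE negb_or => /andP[/negPf ->].
  exact: xpath.
have xab : x a = x b.
  apply: xedge => //; apply/eqP => /setP/(_ b); rewrite !inE eqxx orbT.
  move=> /esym/orP[/eqP bl|/eqP ba]; first by rewrite -bl eqxx in lb.
  by rewrite ba inE eqxx in anbs.
have al : l != a by apply: contraNneq anbs => <-; rewrite /l mem_last.
have := xT e la; rewrite eqxx cobd2 // xlb xab F2_addxx => /eqP.
by rewrite eq_sym oner_eq0.
Qed.

(** Both sides expand over edge sets [T]; for a spanning tree the product of the values outside [T]
    is 1 exactly when all those edges lie in the support of [a]. *)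
Lemma kirchhoff_eval (u : G) (a : {ffun 'I_#|edges G| -> 'F_2}) :
  (map_mpoly (intr : int -> 'F_2) (kirchhoff G)).@[a] =
  pinned_det (edges G) [set enum_val i | i in [pred i | a i != 0]] (pins [:: (u, u)]).
Proof.
rewrite pinned_det_expandM /kirchhoff (rmorph_sum (map_mpoly _)) (rmorph_sum (meval _)) /=.
rewrite [LHS]big_mkcond [RHS]big_mkcond /=.
apply: eq_bigr => T _; case: (boolP (T \subset edges G)) => TG; last first.
  by rewrite /spanning_tree (negPf TG).
rewrite (spanning_tree_det u TG); case: eqVneq => [->|/F2_neq0 ->] /=; first by rewrite mulr0.
rewrite mulr1 (rmorph_prod (map_mpoly _)) (rmorph_prod (meval _)) /=;
  under eq_bigr do rewrite map_mpolyX mevalXU.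
case: (boolP (_ \subset _)) => [/subsetP sub | /subsetPn[e]].
  apply: big1 => i iT; apply: F2_neq0.
  have : enum_val i \in edges G :\: T by rewrite inE iT enum_valP.
  by move/sub/imsetP => [j]; rewrite inE => aj /enum_val_inj ->.
rewrite inE => /andP[eT eG] eA; pose i := enum_rank_in eG e.
have iE : enum_val i = e by apply: enum_rankK_in.
rewrite (bigD1 i) ?iE //= (_ : a i = 0) ?mul0r //; apply/eqP; apply: contraNT eA => ai.
by apply/imsetP; exists i.
Qed.

Lemma zero_count_kirchhoff (u : G) :
  zero_count 2 (kirchhoff G) =
  (\sum_(A : {set {set G}} | A \subset edges G)
     (pinned_det (edges G) A (pins [:: (u, u)]) == 0%R))%N.
Proof.
pose f (a : {ffun 'I_#|edges G| -> 'F_2}) := [set enum_val i | i in [pred i | a i != 0]].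
have mem_f a i : (enum_val i \in f a) = (a i != 0).
  by rewrite mem_imset //; apply: enum_val_inj.
have f_inj : injective f.
  by move=> a b ab; apply/ffunP => i; apply: F2_eq_zero; apply: negb_inj; rewrite -!mem_f ab.
rewrite /zero_count -(card_imset _ f_inj) -sum1_card [RHS](bigID (fun A => pinned_det (edges G) A
  (pins [:: (u, u)]) == 0)) /=.
rewrite [X in (_ + X)%N]big1 => [|A /andP[_ /negPf ->] //]; rewrite addn0.
rewrite [RHS](eq_bigr (fun=> 1%N)) => [|A /andP[_ ->] //].
apply: eq_bigl => A; apply/imsetP/andP => [[a]|[/subsetP AG A0]].
  rewrite inE (kirchhoff_eval u) => a0 ->; split=> //.
  by apply/subsetP => e /imsetP[i _ ->]; apply: enum_valP.
have AE : A = f [ffun i => (enum_val i \in A)%:R].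
  apply/setP => e; apply/idP/imsetP => [eA|[i]]; last first.
    by rewrite inE ffunE => + ->; case: (_ \in A).
  exists (enum_rank_in (AG e eA) e); last by rewrite enum_rankK_in ?AG.
  by rewrite inE ffunE enum_rankK_in ?AG // eA.
by exists [ffun i => (enum_val i \in A)%:R]; rewrite // inE (kirchhoff_eval u) -/(f _) -AE.
Qed.

End SpanningTree.

(** * Graphs with a reflection fixing a vertex of degree three *)

Section ReflectedGraph.
Variables (G : sgraph) (u w1 w2 w3 : G) (rho : G -> G).
Hypothesis U : uniq [:: u; w1; w2; w3].
Hypothesis nbrs : forall z, adj u z = (z \in [:: w1; w2; w3]).
Hypothesis rhoK : involutive rho.
Hypothesis rho_adj : forall a b, adj (rho a) (rho b) = adj a b.
Hypothesis rho_u : rho u = u.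
Hypothesis rho_w1 : rho w1 = w2.
Hypothesis rho_w3 : rho w3 = w3.

Definition edges_off : {set {set G}} := [set e in edges G | u \notin e].

(** The number of zeros is [4 * n] modulo 8, and [n] is even by [sum_q], so 8 divides the count and
    the quotient by [2 ^ 2] is even. *)
Lemma c2_reflected :
    (forall T F : {set {set G}},
      T \subset edges_off -> F \subset edges_off -> [disjoint T & F] ->
      redges rho T = T -> redges rho F = F -> forall w c : G,
      exists x x' : G -> 'F_2,
        [/\ all (fun v => x v == 0) [:: u; w3], all (fun v => x' v == 0) [:: u; w; c],
            {in T, forall e, cobd x e = 0}, {in F, forall e, cobd x' e = 0}
          & (exists v, x v != 0) \/ (exists v, x' v != 0)]) ->
  c2 2 G = 0%N.
Proof.
move=> no_pair.
have D2 : {in edges_off, forall e : {set G}, #|e| = 2%N}.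
  by move=> e; rewrite inE => /andP[/edgesP[a [b [_ ab ->]]] _]; rewrite cards2 ab.
have Du : {in edges_off, forall e : {set G}, u \notin e} by move=> e; rewrite inE => /andP[].
have starE : edges G = with_star edges_off u w1 w2 w3.
  apply/setP => e; rewrite !inE; apply/idP/or4P => [eG|].
    case: (boolP (u \in e)) => ue; last by apply: Or44; rewrite eG.
    have /edgesP[a [b [ab neq E]]] := eG.
    have [z uz ->] : exists2 z, adj u z & e = [set u; z].
      move: ue; rewrite E !inE => /orP[/eqP ->|/eqP ->]; first by exists b.
      by exists a; [rewrite adj_sym | rewrite setUC].
    by move: uz; rewrite nbrs !inE => /or3P[] /eqP ->; [apply: Or41 | apply: Or42 | apply: Or43].
  have star z : adj u z -> [set u; z] \in edges G by move=> uz; apply/imsetP; exists (u, z);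
    rewrite ?inE.
  by case=> [/eqP ->|/eqP ->|/eqP ->|/andP[] //]; apply: star; rewrite nbrs !inE eqxx ?orbT.
have rho_D : redges rho edges_off = edges_off.
  have H e : e \in edges_off -> redge rho e \in edges_off.
    rewrite !inE (mem_redge rhoK) rho_u => /andP[/edgesP[a [b [ab _ ->]]] ->]; rewrite andbT.
    by apply/imsetP; exists (rho a, rho b); rewrite ?inE /= ?rho_adj // /redge imsetU1 imset_set1.
  apply/setP => e; rewrite (mem_redges rhoK); apply/idP/idP; last exact: H.
  by move/H; rewrite (redgeK rhoK).
have Z := zeros_star D2 Du U; rewrite -starE -(zero_count_kirchhoff u) in Z.
have Q := sum_q U rhoK rho_u rho_w1 rho_w3 rho_D no_pair.
set n := (\sum_(A | _) _)%N in Z.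
have /dvdnP[m nE] : (2 %| n)%N.
  rewrite (dvdn_pcharf (pchar_Fp (isT : prime 2))) -[X in _ == X]Q natr_sum; apply/eqP.
  apply: eq_bigr => A _; set q := (X in X != 0).
  by rewrite -/q; case: (F2_cases q) => ->.
have /dvdnP[m' zE] : (8 %| zero_count 2 (kirchhoff G))%N.
  by rewrite /dvdn Z nE mulnCA -[(4 * 2)%N]/8%N modnMl.
by rewrite /c2 zE (_ : 8 = 2 * 2 ^ 2)%N // mulnA mulnK // modnMl.
Qed.

End ReflectedGraph.

(** * Toroidal grids *)

Lemma common_zero (F : fieldType) (C U : finType) (l : C -> U -> F) : (#|C| < #|U|)%N ->
  exists2 z : U -> F, (exists a, z a != 0) & forall c, \sum_a l c a * z a = 0.
Proof.
move=> CU; pose A := \matrix_(i < #|U|, j < #|C|) l (enum_val j) (enum_val i).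
have /rowV0Pn[v /sub_kermxP vA vN0] : kermx A != 0.
  rewrite kermx_eq0; apply/negP => /eqP rA.
  by have := rank_leq_col A; rewrite rA leqNgt CU.
exists (fun a => v 0 (enum_rank a)).
  by have /rV0Pn[j vj] := vN0; exists (enum_val j); rewrite enum_valK.
move=> c; move/rowP/(_ (enum_rank c)): vA; rewrite !mxE => {2}<-.
rewrite -sum_enum_val; apply: eq_bigr => i _.
by rewrite enum_valK !mxE enum_rankK mulrC.
Qed.

Lemma ordS_add1 n (i : 'I_n.+3) : ordS i = i + 1.
Proof. by apply/val_inj; rewrite /= modnDmr addn1. Qed.

Lemma cycle_adjE n (i j : 'I_n.+3) : cycle_adj i j = (j == i + 1) || (i == j + 1).
Proof.
rewrite /cycle_adj !ordS_add1; case: (eqVneq i j) => //= ->.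
by rewrite -subr_eq0 opprD addNKr oppr_eq0 oner_eq0.
Qed.

(** * Folding a cycle along a reflection *)

Section Folding.
Variables (n : nat) (i0 : 'I_n.+3).
Implicit Type i : 'I_n.+3.

Definition mirror i := i0 + i0 - i.
Definition offset i : nat := val (i - i0).
(** Distance from [i0] in the cycle; it labels the orbits of [mirror], hence the columns of the
    quotient. *)
Definition level i : nat := minn (offset i) (n.+3 - offset i).

Lemma mirrorK : involutive mirror.
Proof. by move=> i; rewrite /mirror subKr. Qed.

Lemma offset_lt i : (offset i < n.+3)%N.
Proof. exact: ltn_ord. Qed.

Lemma offsetK i : i0 + (offset i)%:R = i.
Proof. by rewrite /offset natr_Zp addrC subrK. Qed.

Lemma offset_add d : (d < n.+3)%N -> offset (i0 + d%:R) = d.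
Proof.
move=> dn; rewrite /offset addrC addKr.
exact: etrans (@val_Zp_nat n.+3 isT d) (modn_small dn).
Qed.

Lemma order_eq0 : n.+3%:R = 0 :> 'I_n.+3.
Proof. by apply/val_inj; apply: etrans (@val_Zp_nat n.+3 isT n.+3) (modnn _). Qed.

Lemma level_max i : (level i <= n.+3./2)%N.
Proof. rewrite /level; have := offset_lt i; lia. Qed.

Lemma level_add d : (d <= n.+3./2)%N -> level (i0 + d%:R) = d.
Proof. move=> dn; rewrite /level offset_add; lia. Qed.

Lemma level_unfold i : i0 + (level i)%:R = i \/ i0 + (level i)%:R = mirror i.
Proof.
rewrite /level; case: (leqP (offset i) (n.+3 - offset i)) => H.
  by left; rewrite offsetK.
right; rewrite natrB ?(ltnW (offset_lt _)) // order_eq0 /mirror.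
by rewrite -{2}(offsetK i); ring.
Qed.

Lemma level_eq0 i : level i = 0%N -> i = i0.
Proof.
have := level_unfold i; rewrite /level => _ H; have := offset_lt i.
by move=> lt; have o0 : offset i = 0%N by [lia]; rewrite -(offsetK i) o0 addr0.
Qed.

Lemma offset_step i : offset (i + 1) = if (offset i).+1 == n.+3 then 0%N else (offset i).+1.
Proof.
rewrite /offset addrAC; move: (i - i0) => j /=.
have := ltn_ord j; rewrite modnDmr addn1 leq_eqVlt; case: eqP => [-> _|_ /= lt]; first exact: modnn.
by rewrite modn_small.
Qed.

(** The level stays the same only on an edge flipped by [mirror], opposite [i0] in an odd cycle.
    Otherwise the second component tells whether the step or its mirror image lies in the half
    represented by levels. *)
Lemma level_step i :
  [\/ level (i + 1) = level i,
      level (i + 1) = (level i).+1 /\ i0 + (level i)%:R = i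
    | level i = (level (i + 1)).+1 /\ i0 + (level (i + 1))%:R = mirror (i + 1)].
Proof.
have small i' : (offset i' <= n.+3 - offset i')%N -> i0 + (level i')%:R = i'.
  by move=> H; rewrite /level (minn_idPl H) offsetK.
have large i' : (n.+3 - offset i' <= offset i')%N -> i0 + (level i')%:R = mirror i'.
  move=> H; rewrite /level (minn_idPr H) natrB ?(ltnW (offset_lt _)) // order_eq0 /mirror.
  by rewrite -{2}(offsetK i'); ring.
have lt := offset_lt i; have step := offset_step i.
case: (ltngtP (level (i + 1)) (level i)) => H; [apply: Or33 | apply: Or32 | by apply: Or31].
  case: (eqVneq (offset i).+1 n.+3) step => E step.
    have i1 : i + 1 = i0 by rewrite -(offsetK (i + 1)) step addr0.
    rewrite /level step i1 /mirror; split; first by move: E; lia.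
    by rewrite min0n addr0 addrK.
  split; last apply: large; move: H lt; rewrite /level step; lia.
case: (eqVneq (offset i).+1 n.+3) step => E step.
  by move: H; rewrite /level step min0n.
split; last apply: small; move: H lt; rewrite /level step; lia.
Qed.

End Folding.

(** * The torus without a vertex and its quotient by the reflection *)

Section Torus.
Variables (m n : nat) (v : cartesian (cycle_graph m.+3) (cycle_graph n.+3)).

Let P : finType := ('I_m.+3 * 'I_n.+3)%type.
Let G := del_vertex v.

Lemma torus_adjE (a b : G) : adj a b =
  ((val a).1 == (val b).1) && (((val b).2 == (val a).2 + 1) || ((val a).2 == (val b).2 + 1)) ||
  (((val b).1 == (val a).1 + 1) || ((val a).1 == (val b).1 + 1)) && ((val a).2 == (val b).2).
Proof.
by rewrite /= /del_adj /= /cartesian_adj /= !cycle_adjE.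
Qed.

Definition mir (p : P) : P := (mirror v.1 p.1, p.2).

Lemma mirK : involutive mir.
Proof. by move=> [i j]; rewrite /mir mirrorK. Qed.

Lemma mir_root : mir v = v.
Proof. by rewrite /mir /mirror addrK -surjective_pairing. Qed.

Fact mir_neq (a : G) : mir (val a) != v.
Proof. by rewrite -[X in _ != X]mir_root (inj_eq (inv_inj mirK)) (valP a). Qed.

Definition gmir (a : G) : G := exist _ (mir (val a)) (mir_neq a).

Lemma gmirK : involutive gmir.
Proof. by move=> a; apply: val_inj; rewrite /= mirK. Qed.

Lemma mirror_add1 (i j : 'I_m.+3) : (mirror v.1 i == mirror v.1 j + 1) = (j == i + 1).
Proof.
rewrite /mirror -[X in _ = X](inj_eq (addrI (v.1 + v.1 - i - j))).
by congr (_ == _); ring.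
Qed.

Lemma gmir_adj (a b : G) : adj (gmir a) (gmir b) = adj a b.
Proof.
rewrite !torus_adjE /= !mirror_add1 (inj_eq (inv_inj (@mirrorK _ _))).
by rewrite [in X in _ || X && _]orbC.
Qed.

Fact neq_root (i : 'I_m.+3) (j : 'I_n.+3) : (i != v.1) || (j != v.2) -> ((i, j) : P) != v.
Proof. by rewrite -negb_and -xpair_eqE -surjective_pairing. Qed.

Fact add1_neq k (i : 'I_k.+3) : i + 1 != i.
Proof. by rewrite -subr_eq0 addrAC subrr add0r oner_eq0. Qed.

Fact sub1_neq k (i : 'I_k.+3) : i - 1 != i.
Proof. by rewrite -subr_eq0 addrAC subrr add0r oppr_eq0 oner_eq0. Qed.

Fact add2_neq k (i : 'I_k.+3) : i + 1 + 1 != i.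
Proof. by rewrite -(addrA i) -subr_eq0 [_ - i]addrC addKr. Qed.

(** A neighbour of [v] on the line fixed by the reflection; its remaining neighbours are a swapped
    pair and a fixed vertex. *)
Definition gu : G := exist _ (v.1, v.2 + 1) (neq_root (introT orP (or_intror (add1_neq _)))).
Definition gw1 : G := exist _ (v.1 + 1, v.2 + 1) (neq_root (introT orP (or_intror (add1_neq _)))).
Definition gw2 : G := exist _ (v.1 - 1, v.2 + 1) (neq_root (introT orP (or_intror (add1_neq _)))).
Definition gw3 : G := exist _ (v.1, v.2 + 1 + 1) (neq_root (introT orP (or_intror (add2_neq _)))).

Lemma gmir_u : gmir gu = gu.
Proof. by apply: val_inj; rewrite /= /mir /mirror /= addrK. Qed.

Lemma gmir_w1 : gmir gw1 = gw2.
Proof. by apply: val_inj; rewrite /= /mir /mirror /= opprD addrA addrK. Qed.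

Lemma gmir_w3 : gmir gw3 = gw3.
Proof. by apply: val_inj; rewrite /= /mir /mirror /= addrK. Qed.

Lemma uniq_uw : uniq [:: gu; gw1; gw2; gw3].
Proof.
rewrite /= !inE -!(inj_eq val_inj) /= !xpair_eqE !eqxx !andbT.
have a1 := negPf (add1_neq v.1); have s1 := negPf (sub1_neq v.1).
have a2 := negPf (add1_neq (v.2 + 1)).
have as1 : (v.1 + 1 == v.1 - 1) = false.
  by apply/negbTE; have := add2_neq (v.1 - 1); rewrite subrK.
by rewrite ![v.1 == _]eq_sym [_ == v.2 + 1 + 1]eq_sym a1 s1 a2 as1.
Qed.

Lemma adj_gu (z : G) : adj gu z = (z \in [:: gw1; gw2; gw3]).
Proof.
have vE (a b : G) : (a == b) = (val a == val b) by [].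
have zv := valP z; rewrite torus_adjE !inE !vE.
rewrite (_ : val gu = (v.1, v.2 + 1)) // (_ : val gw1 = (v.1 + 1, v.2 + 1)) //.
rewrite (_ : val gw2 = (v.1 - 1, v.2 + 1)) // (_ : val gw3 = (v.1, v.2 + 1 + 1)) //.
case: (val z) zv => a b; rewrite [X in _ != X]surjective_pairing !xpair_eqE; cbn [fst snd].
rewrite -(subr_eq v.1) (inj_eq (addIr 1)) ![_ == a]eq_sym ![_ == b]eq_sym.
by do 6!case: (_ == _).
Qed.

Let u := gu.

(** The value [gu] at [v] is a mere default: slots with an end at [v] are excluded below. *)
Definition to_G (p : P) : G := insubd gu p.

Lemma to_GK (p : P) : p != v -> val (to_G p) = p.
Proof. by move=> pv; rewrite /to_G val_insubd pv. Qed.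

Lemma val_to_G (a : G) : to_G (val a) = a.
Proof. exact: valKd. Qed.

Let h := m.+1./2.

(* Edges of the quotient of the torus by [mir], which is the grid on the columns
   [0 .. h.+1], [h.+1] being [m.+3./2].  Torus edges flipped by [mir] have no slot. *)
Let slot : finType := ('I_h.+1 * 'I_n.+3 + 'I_h.+2 * 'I_n.+3)%type.

Definition slot_ends (s : slot) : (nat * 'I_n.+3) * (nat * 'I_n.+3) :=
  match s with
  | inl (d, j) => ((nat_of_ord d, j), (d.+1, j))
  | inr (d, j) => ((nat_of_ord d, j), (nat_of_ord d, j + 1))
  end.

Definition node (q : nat * 'I_n.+3) : P := (v.1 + q.1%:R, q.2).

Definition slot_edge s : {set G} :=
  [set to_G (node (slot_ends s).1); to_G (node (slot_ends s).2)].

(* The slots meeting the deleted vertex [v] or [gu]. *)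
Definition excluded : seq slot :=
  [:: inl (ord0, v.2); inl (ord0, v.2 + 1); inr (ord0, v.2 - 1); inr (ord0, v.2);
      inr (ord0, v.2 + 1)].

Let unknown : finType := (bool * ('I_h.+2 * 'I_n.+3))%type.

(* One equation per remaining slot, and seven vanishing conditions: both functions
   at [v] and [gu], the first one at [gw3], the second one at [w] and [c]. *)
Let constraint : finType := ({s : slot | s \notin excluded} + 'I_7)%type.

(** With N = [n.+3], there are (2h+3)N - 5 slot equations and 7 vanishing conditions for 2(h+2)N
    unknowns; the inequality amounts to 2 < N. *)
Lemma card_constraint : (#|constraint| < #|unknown|)%N.
Proof.
have ue : uniq excluded.
  have inlE (a b : 'I_h.+1 * 'I_n.+3) : (inl a == inl b :> slot) = (a == b) by [].
  have inrE (a b : 'I_h.+2 * 'I_n.+3) : (inr a == inr b :> slot) = (a == b) by [].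
  have a1 := negPf (add1_neq v.2); have s1 := negPf (sub1_neq v.2).
  have as1 : (v.2 - 1 == v.2 + 1) = false.
    by apply/negbTE; have := add2_neq (v.2 - 1); rewrite subrK eq_sym.
  by rewrite /= !inE !inlE !inrE !xpair_eqE !eqxx ![v.2 == _]eq_sym a1 s1 as1.
rewrite card_sum card_sig card_ord card_prod card_bool card_prod !card_ord.
have := cardC (mem excluded); rewrite (card_uniqP ue) card_sum !card_prod !card_ord /=.
rewrite (eq_card (B := [pred s | s \notin excluded])) => [|s]; last by rewrite !inE.
by set k := #|_|; lia.
Qed.

Lemma mem_excluded_inl (d : 'I_h.+1) (j : 'I_n.+3) :
  (inl (d, j) : slot) \in excluded -> d = 0%N :> nat /\ (j == v.2) || (j == v.2 + 1).
Proof.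
rewrite !inE => /or4P[/eqP[-> ->]|/eqP[-> ->]|//|//]; by rewrite eqxx ?orbT.
Qed.

Lemma mem_excluded_inr (d : 'I_h.+2) (j : 'I_n.+3) :
  (inr (d, j) : slot) \in excluded ->
  d = 0%N :> nat /\ [|| j + 1 == v.2, j == v.2 | j == v.2 + 1].
Proof.
rewrite !inE => /or4P[//|//|/eqP[-> ->]|/orP[]/eqP[-> ->]]; by rewrite ?subrK eqxx ?orbT.
Qed.


(** Both functions live on the quotient grid, [true] marking the one for [T] and [false] the one for
    [F]. A slot imposes at most one equation since [T] and [F] are disjoint, and unfolding gives
    mirror-invariant functions on the graph. *)
Lemma reflected_pair (T F : {set {set G}}) (w c : G) :
    T \subset edges_off u -> F \subset edges_off u -> [disjoint T & F] ->
    redges gmir T = T -> redges gmir F = F ->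
    exists x x' : G -> 'F_2,
      [/\ all (fun a => x a == 0) [:: u; gw3], all (fun a => x' a == 0) [:: u; w; c],
          {in T, forall e, cobd x e = 0}, {in F, forall e, cobd x' e = 0}
        & (exists a, x a != 0) \/ (exists a, x' a != 0)].
Proof.
move=> TD FD TF rT rF.
pose cell (q : nat * 'I_n.+3) : 'I_h.+2 * 'I_n.+3 := (inord q.1, q.2).
pose fold (p : P) := cell (level v.1 p.1, p.2).
pose pinned : seq unknown := [:: (true, fold v); (false, fold v); (true, fold (val u));
  (false, fold (val u)); (true, fold (val gw3)); (false, fold (val w)); (false, fold (val c))].
pose dirac (q : unknown) (q' : unknown) : 'F_2 := (q' == q)%:R.
pose eqn (s : slot) b (q' : unknown) : 'F_2 :=
  dirac (b, cell (slot_ends s).1) q' + dirac (b, cell (slot_ends s).2) q'.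
pose l (k : constraint) (q' : unknown) : 'F_2 := match k with
  | inl s => if slot_edge (val s) \in T then eqn (val s) true q'
             else if slot_edge (val s) \in F then eqn (val s) false q' else 0
  | inr i => dirac (nth (true, fold v) pinned i) q'
  end.
have [z [q qN0] zl] := common_zero l card_constraint.
have sum_dirac q' : \sum_a dirac q' a * z a = z q'.
  by rewrite sum_natb (big_pred1 q').
have sum_eqn s b : \sum_a eqn s b a * z a = z (b, cell (slot_ends s).1) + z (b, cell (slot_ends
  s).2).
  by under eq_bigr do rewrite mulrDl; rewrite big_split /= !sum_dirac.
have z_pin : all (fun q' => z q' == 0) pinned.
  apply/(all_nthP (true, fold v)) => i i7.
  by have := zl (inr (Ordinal i7)); rewrite /= sum_dirac => ->.
have z_slot s b : s \notin excluded -> slot_edge s \in (if b then T else F) ->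
    z (b, cell (slot_ends s).1) = z (b, cell (slot_ends s).2).
  move=> sN eb; apply: F2_add_eq0; rewrite -sum_eqn -[RHS](zl (inl (exist _ s sN))) /=.
  case: b eb => eb; first by rewrite eb.
  by rewrite (disjointFl TF eb) eb.
pose x b (a : G) := z (b, fold (val a)).
have fold_ord i : (level v.1 i < h.+2)%N by rewrite ltnS; apply: level_max.
have redge_mem (S : {set {set G}}) (a a' : G) : redges gmir S = S -> [set a; a'] \in S ->
    [set gmir a; gmir a'] \in S.
  move=> rS aS; rewrite -rS (mem_redges gmirK) /redge imsetU1 imset_set1.
  by rewrite !gmirK.
have not_root (a : G) : val a = v -> False by move=> av; have := valP a; rewrite av eqxx.
have not_u (a : G) : a != u -> val a = (v.1, v.2 + 1) -> False.
  by move=> /eqP au av; apply: au; apply: val_inj.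
(* The slot of the edge is not excluded, because neither end is [v] or [gu]. Its [slot_edge] is the
   edge or its mirror image, and the invariant edge set contains both. *)
have x_const b (a a' : G) : [set a; a'] \in (if b then T else F) -> a != u -> a' != u ->
    (val a' = ((val a).1, (val a).2 + 1)) \/ (val a' = ((val a).1 + 1, (val a).2)) ->
    x b a = x b a'.
  set S := if b then T else F.
  have rS : redges gmir S = S by rewrite /S; case: (b).
  move=> aS au a'u; have [i [j aE]] : exists i j, val a = (i, j).
    by exists (val a).1, (val a).2; rewrite -surjective_pairing.
  rewrite /x aE; cbn [fst snd]; case=> a'E; rewrite a'E /fold; cbn [fst snd].
    pose s : slot := inr (inord (level v.1 i), j).
    have sE : slot_ends s = ((level v.1 i, j), (level v.1 i, j + 1)).
      by rewrite /= inordK // fold_ord.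
    have := @z_slot s b; rewrite sE; apply.
      apply/negP => /mem_excluded_inr; rewrite inordK ?fold_ord // => -[/level_eq0 iv].
      move=> /or3P[] /eqP jv.
      - by apply: (@not_root a'); rewrite a'E iv jv -surjective_pairing.
      - by apply: (@not_root a); rewrite aE iv jv -surjective_pairing.
      by apply: (@not_u a au); rewrite aE iv jv.
    rewrite -/S /slot_edge sE /node; cbn [fst snd].
    case: (level_unfold v.1 i) => ->.
      by rewrite -aE -a'E !val_to_G.
    have E1 : to_G (mirror v.1 i, j) = gmir a by rewrite -[RHS]val_to_G -[val _]/(mir (val a)) aE.
    have E2 : to_G (mirror v.1 i, j + 1) = gmir a' by rewrite -[RHS]val_to_G -[val _]/(mir (val
      a')) a'E.
    by rewrite E1 E2; apply: redge_mem.
  have in_range d i' : level v.1 i' = d.+1 -> (d < h.+1)%N.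
    by move=> E; have := fold_ord i'; rewrite E.
  (* A step preserving the level joins two vertices with the same folded image, where equality is
     automatic. *)
  case: (level_step v.1 i) => [->//|[li iE]|[li iE]].
    pose s : slot := inl (inord (level v.1 i), j).
    have sE : slot_ends s = ((level v.1 i, j), ((level v.1 i).+1, j)).
      by rewrite /= inordK // (in_range _ _ li).
    have := @z_slot s b; rewrite sE li; apply.
      apply/negP => /mem_excluded_inl; rewrite inordK ?(in_range _ _ li) // => -[/level_eq0 iv].
      move=> /orP[] /eqP jv.
      - by apply: (@not_root a); rewrite aE iv jv -surjective_pairing.
      by apply: (@not_u a au); rewrite aE iv jv.
    rewrite -/S /slot_edge sE /node; cbn [fst snd].
    by rewrite -natr1 addrA iE -aE -a'E !val_to_G.
  (* On the half where levels decrease, the slot starts at the level of [a'] and its edge is the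
     mirror image of the given one. *)
  pose s : slot := inl (inord (level v.1 (i + 1)), j).
  have sE : slot_ends s = ((level v.1 (i + 1), j), ((level v.1 (i + 1)).+1, j)).
    by rewrite /= inordK // (in_range _ _ li).
  have := @z_slot s b; rewrite sE li => H; apply/esym/H.
    apply/negP => /mem_excluded_inl; rewrite inordK ?(in_range _ _ li) // => -[/level_eq0 iv].
    move=> /orP[] /eqP jv.
    - by apply: (@not_root a'); rewrite a'E iv jv -surjective_pairing.
    by apply: (@not_u a' a'u); rewrite a'E iv jv.
  rewrite -/S /slot_edge sE /node; cbn [fst snd].
  rewrite -natr1 addrA iE (_ : mirror v.1 (i + 1) + 1 = mirror v.1 i); last first.
    by apply/eqP; rewrite eq_sym mirror_add1.
  have E1 : to_G (mirror v.1 i, j) = gmir a by rewrite -[RHS]val_to_G -[val _]/(mir (val a)) aE.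
  have E2 : to_G (mirror v.1 (i + 1), j) = gmir a' by rewrite -[RHS]val_to_G -[val _]/(mir (val
    a')) a'E.
  by rewrite E1 E2 setUC; apply: redge_mem.
have x_edges b : {in (if b then T else F), forall e, cobd (x b) e = 0}.
  move=> e eS; have : e \in edges_off u by case: b eS => ?;
    [apply: (subsetP TD) | apply: (subsetP FD)].
  rewrite inE => /andP[/edgesP[a [a' [aa' neq E]]]].
  rewrite E !inE negb_or ![u == _]eq_sym => /andP[au a'u].
  rewrite E cobd2 // in eS *.
  suff -> : x b a = x b a' by apply: F2_addxx.
  have eS' : [set a'; a] \in (if b then T else F) by rewrite setUC.
  move: aa'; rewrite torus_adjE => /orP[/andP[/eqP E1 /orP[]/eqP E2]|/andP[/orP[]/eqP E1 /eqP E2]].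
  - by apply: x_const => //; left; rewrite E1 -E2 -surjective_pairing.
  - by apply/esym; apply: x_const => //; left; rewrite -E1 -E2 -surjective_pairing.
  - by apply: x_const => //; right; rewrite E2 -E1 -surjective_pairing.
  by apply/esym; apply: x_const => //; right; rewrite -E2 -E1 -surjective_pairing.
case/and5P: z_pin => zv zv' zu zu' /and4P[zw3 zw zc _].
exists (x true), (x false); split.
- by rewrite /= zu zw3.
- by rewrite /= zu' zw zc.
- exact: (x_edges true).
- exact: (x_edges false).
case: q qN0 => b [d j] qN0.
have foldE : fold (node (nat_of_ord d, j)) = (d, j).
  by rewrite /fold /cell /= level_add ?inord_val // -ltnS; exact: (ltn_ord d).
(* Both functions are required to vanish at the cell of [v], so a nonzero value sits over a vertex
   of the graph. *)
have pv : node (nat_of_ord d, j) != v.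
  apply: contraNneq qN0 => pv; rewrite -foldE pv; by case: b.
have N0 : x b (to_G (node (nat_of_ord d, j))) != 0 by rewrite /x to_GK // foldE.
by case: b {qN0} N0 => N0; [left | right]; exists (to_G (node (nat_of_ord d, j))).
Qed.

End Torus.

Local Close Scope ring_scope.

Theorem proposition3p2 (N k : nat) (hN : 3 <= N) (hk : 3 <= k)
    (v : cartesian (cycle_graph k) (cycle_graph N))
    (hV : 3 * N - 1 <= #|del_vertex v|) :
  c2 2 (del_vertex v) = 0.
Proof.
case: N k hN hk v {hV} => [|[|[|n]]] // [|[|[|m]]] // _ _ v.
apply: (@c2_reflected _ (gu v) (gw1 v) (gw2 v) (gw3 v) (@gmir _ _ v)).
- exact: uniq_uw.
- exact: adj_gu.
- exact: gmirK.
- exact: gmir_adj.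
- exact: gmir_u.
- exact: gmir_w1.
- exact: gmir_w3.
by move=> T F TD FD TF rT rF w c; apply: reflected_pair.
Qed.
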